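(* Let $(N,h,Z)$ be a lightlike manifold of dimension $m+1$, and let $(\mathcal T,\mathbf h,\nabla^{\mathcal T},\xi)$ be a lightlike extension vector bundle for $(N,h,Z)$, with associated maps $\tau\mapsto\nabla^\tau$ and $D:\tau\mapsto D^\tau$. Assume that $m\ge3$ and that $R^{\mathcal T}(V,W)\xi$ and $R^{\mathcal T}(Z,V)\Phi(W)$ are collinear with $\xi$ for every $V,W\in\mathfrak X(N)$. Then the following statements are equivalent: (1) The Ricci-type contraction $\mathrm{trace}\big([U]\mapsto\mathcal W([U],[V])[W]\big)$ vanishes (for all $V,W\in\mathfrak X(N)$). (2) For each $\tau\in S(N,h,Z)$, the map $D$ satisfies $$h(D^\tau(X),Y)=\frac1{m-2}\left(\mathrm{Ric}^\tau(X,Y)-\frac{S^\tau}{2(m-1)}h(X,Y)\right)$$ for every $X,Y\in\Gamma(\mathrm{An}(\tau))$, where $S^\tau:=\sum_{i=1}^m\mathrm{Ric}^\tau(E_i,E_i)$ and $(E_1,\dots,E_m)$ is a local frame of $\mathrm{An}(\tau)$ with $h(E_i,E_j)=\delta_{ij}$.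
   Context: Manifolds are smooth, Hausdorff, connected, second countable. A lightlike manifold $(N,h,Z)$ is an $(m+1)$-dimensional manifold with a symmetric positive semidefinite $(0,2)$-tensor $h$ whose radical $\mathrm{Rad}(h)=\{v:h(v,\cdot)=0\}$ is one-dimensional at each point and a vector field $Z$ spanning it everywhere. $\mathcal E=TN/\mathrm{Rad}(h)$, with classes denoted $[V]$. $S(N,h,Z)=\{\tau\in\Omega^1(N,\mathbb R):\tau(Z)=1\}$, $\mathrm{An}(\tau)=\ker\tau\subset TN$ (on which $h$ is positive definite). A lightlike extension vector bundle over $N$ is a quadruple $(\mathcal T,\mathbf h,\nabla^{\mathcal T},\xi)$: a real vector bundle $\mathcal T\to N$ of rank $m+2$ with a bundle metric $\mathbf h$ of Lorentzian signature, a linear connection $\nabla^{\mathcal T}$ with $\nabla^{\mathcal T}\mathbf h=0$, and a lightlike section $\xi$ such that $\Phi(W):=\nabla^{\mathcal T}_W\xi$ defines a vector bundle monomorphism $\Phi:TN\to\mathcal T$. Then $\Phi(TN)=\xi^\perp$. It is for $(N,h,Z)$ if $h(V,W)=\mathbf h(\Phi(V),\Phi(W))$ and $\Phi(Z)=\xi$. $R^{\mathcal T}(V,W)T=\nabla^{\mathcal T}_V\nabla^{\mathcal T}_WT-\nabla^{\mathcal T}_W\nabla^{\mathcal T}_VT-\nabla^{\mathcal T}_{[V,W]}T$. ''Collinear with $\xi$'' means equal to $f\xi$ for some function $f$ (possibly zero). Under the two collinearity assumptions, $\mathcal W([U],[V])[W]:=[\Phi^{-1}(R^{\mathcal T}(U,V)\Phi(W))]$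 is a well-defined section of $\Lambda^2\mathcal E^*\otimes L(\mathcal E,\mathcal E)$. For $\tau\in S(N,h,Z)$ let $\eta^\tau$ be the unique lightlike section of $\mathcal T$ with $\mathbf h(\xi,\eta^\tau)=1$ and $\mathbf h(\Phi(\mathrm{An}(\tau)),\eta^\tau)=0$; every section of $\mathcal T$ is uniquely $\alpha\xi+\Phi(X)+\beta\eta^\tau$ with $X\in\Gamma(\mathrm{An}(\tau))$. For $X\in\Gamma(\mathrm{An}(\tau))$, $W\in\mathfrak X(N)$, $\nabla^\tau_WX$ and $D^\tau(W)$ are the $\mathrm{An}(\tau)$-components of $\nabla^{\mathcal T}_W\Phi(X)$ and $\nabla^{\mathcal T}_W\eta^\tau$ respectively; $\nabla^\tau$ is a metric linear connection on $(\mathrm{An}(\tau)\to N,h)$ and $D^\tau:TN\to\mathrm{An}(\tau)$ is a vector bundle morphism. $R^\tau(V,W)X=\nabla^\tau_V\nabla^\tau_WX-\nabla^\tau_W\nabla^\tau_VX-\nabla^\tau_{[V,W]}X$ and $\mathrm{Ric}^\tau(X,Y)=\sum_{i=1}^mh(R^\tau(E_i,X)Y,E_i)$ for $X,Y\in\Gamma(\mathrm{An}(\tau))$. *)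

(* Defs.v *)
From HB Require Import structures.
From mathcomp Require Import all_boot all_order all_algebra.
From mathcomp Require Import ring.
From mathcomp Require Import all_classical all_reals all_analysis.
Import numFieldNormedType.Exports.
Import Order.TTheory GRing.Theory Num.Theory.

Set Implicit Arguments.
Unset Strict Implicit.
Unset Printing Implicit Defensive.

Local Open Scope classical_set_scope.
Local Open Scope ring_scope.

Section LinearAlgebra.
Context {R : realType}.

Definition is_basis (V : lmodType R) k (e : 'I_k -> V) : Prop :=
  forall v, exists! a : 'rV[R]_k, v = \sum_i a 0 i *: e i.

Definition bilinear_form (V : lmodType R) (b : V -> V -> R) : Prop :=
  (forall w, scalar (b ^~ w)) /\ (forall v, scalar (b v)).

Definition symmetric_form (V : Type) (b : V -> V -> R) : Prop :=
  forall v w, b v w = b w v.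

(* Signature (-,+,...,+). *)
Definition lorentzian (V : lmodType R) k (b : V -> V -> R) : Prop :=
  exists e : 'I_k.+1 -> V, is_basis e /\
    forall i j, b (e i) (e j) = if i != j then 0 else if i == 0 then -1 else 1.

Definition lightlike (V : lmodType R) (b : V -> V -> R) (v : V) : Prop :=
  v != 0 /\ b v v = 0.

Definition is_trace (V : lmodType R) k (A : V -> V) (c : R) : Prop :=
  exists (e : 'I_k -> V) (a : 'M[R]_k),
    [/\ is_basis e, forall i, A (e i) = \sum_j a i j *: e j & \tr a = c].

End LinearAlgebra.

(* The library's quotient of a zmodule, endowed with its scalar action. *)
Section QuotientModule.
Context {R : pzRingType} (V : lmodType R) (S : submodClosed V).
Local Open Scope quotient_scope.

Definition submod_pred : {pred V} := fun v => v \in S.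
Fact submod_pred_closed : zmod_closed submod_pred.
Proof.
split=> [|v w Sv Sw]; rewrite unfold_in ?rpred0 //.
by rewrite -scaleN1r rpredD ?rpredZ.
Qed.
HB.instance Definition _ := GRing.isZmodClosed.Build V submod_pred
  submod_pred_closed.

Definition lmod_quot : Type := Quotient.quot submod_pred.
HB.instance Definition _ := GRing.Zmodule.on lmod_quot.

Definition lmod_class (v : V) : lmod_quot := \pi_(Quotient.quot submod_pred) v.

Definition lmod_quot_scale (a : R) (q : lmod_quot) : lmod_quot :=
  lmod_class (a *: repr (q : Quotient.quot submod_pred)).

Lemma lmod_class_eq v w : (lmod_class v = lmod_class w) <-> (v - w \in S).
Proof.
rewrite -[v - w \in S]/(v - w \in submod_pred) Quotient.idealrBE.
by split=> [/eqP|/eqP].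
Qed.

Lemma lmod_class_surj (q : lmod_quot) : exists v, q = lmod_class v.
Proof. by exists (repr (q : Quotient.quot submod_pred)); rewrite /lmod_class reprK. Qed.

Lemma lmod_classD v w : lmod_class (v + w) = lmod_class v + lmod_class w.
Proof. exact: Quotient.pi_add. Qed.

Lemma lmod_classZ a v : lmod_class (a *: v) = lmod_quot_scale a (lmod_class v).
Proof.
apply/lmod_class_eq; rewrite -scalerBr rpredZ //.
by apply/lmod_class_eq; rewrite /lmod_class reprK.
Qed.

Fact lmod_quot_scaleA a b q :
  lmod_quot_scale a (lmod_quot_scale b q) = lmod_quot_scale (a * b) q.
Proof.
by have [v ->] := lmod_class_surj q; rewrite -!lmod_classZ scalerA.
Qed.

Fact lmod_quot_scale1 : left_id 1 lmod_quot_scale.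
Proof.
by move=> q; have [v ->] := lmod_class_surj q; rewrite -lmod_classZ scale1r.
Qed.

Fact lmod_quot_scaleDr : right_distributive lmod_quot_scale +%R.
Proof.
move=> a q r; have [v ->] := lmod_class_surj q; have [w ->] := lmod_class_surj r.
by rewrite -!lmod_classZ -!lmod_classD -lmod_classZ scalerDr.
Qed.

Fact lmod_quot_scaleDl q :
  {morph (fun a => lmod_quot_scale a q) : a b / a + b}.
Proof.
move=> a b; have [v ->] := lmod_class_surj q.
by rewrite -!lmod_classZ -lmod_classD scalerDl.
Qed.

HB.instance Definition _ := GRing.Zmodule_isLmodule.Build R lmod_quot
  lmod_quot_scaleA lmod_quot_scale1 lmod_quot_scaleDr lmod_quot_scaleDl.

End QuotientModule.

Section SmoothEuclidean.
Context {R : realType} {n : nat}.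

Definition partial (i : 'I_n) (f : 'rV[R]_n -> R) : 'rV[R]_n -> R :=
  fun x => 'D_(delta_mx 0 i) f x.

(* Only meant for open [U]. *)
Fixpoint Ck_on (k : nat) (U : set 'rV[R]_n) (f : 'rV[R]_n -> R) : Prop :=
  (forall x, U x -> {for x, continuous f}) /\
  (if k is k'.+1 then
     forall i, (forall x, U x -> derivable f x (delta_mx 0 i)) /\
               Ck_on k' U (partial i f)
   else True).

Definition Cinfty_on (U : set 'rV[R]_n) (f : 'rV[R]_n -> R) : Prop :=
  forall k, Ck_on k U f.

End SmoothEuclidean.

Section SmoothEuclideanTheory.
Context {R : realType} {n : nat}.
Implicit Types (U : set 'rV[R]_n) (f g : 'rV[R]_n -> R).

Lemma Ck_on_congr k U f g : open U -> (forall x, U x -> f x = g x) ->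
  Ck_on k U f -> Ck_on k U g.
Proof.
move=> oU; have near_fg f' g' : (forall x, U x -> f' x = g' x) ->
    forall x, U x -> \forall y \near x, f' y = g' y.
  move=> fg x Ux; apply: filterS (open_nbhs_nbhs (conj oU Ux)) => y Uy; exact: fg.
have cg f' g' : (forall x, U x -> f' x = g' x) ->
    (forall x, U x -> {for x, continuous f'}) ->
    forall x, U x -> {for x, continuous g'}.
  move=> fg cf x Ux; rewrite /prop_for /continuous_at -(fg x Ux).
  exact: (cvg_trans (near_eq_cvg (near_fg _ _ fg x Ux)) (cf x Ux)).
elim: k f g => [|k IH] f g fg /= [cf df];
  (split; first exact: cg cf) => // i.
have [dfi Ckf] := df i; split=> [x Ux|].
  exact: near_eq_derivable (near_fg _ _ fg x Ux) (dfi x Ux).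
by apply: IH Ckf => x Ux; exact: near_eq_derive (near_fg _ _ fg x Ux).
Qed.

Lemma Ck_on_le k U f : Ck_on k.+1 U f -> Ck_on k U f.
Proof.
elim: k f => [|k IH] f [cf df]; split=> // i.
by have [dfi Ckf] := df i; split=> //; exact: IH.
Qed.

Lemma Ck_on_lin k U a f g : open U ->
  Ck_on k U f -> Ck_on k U g -> Ck_on k U (a \*: f \+ g).
Proof.
move=> oU; elim: k f g => [|k IH] f g [cf df] [cg dg];
  (split; first by move=> x Ux; apply: continuousD;
     [apply: continuousZr; exact: cf|exact: cg]) => // i.
have [dfi Ckf] := df i; have [dgi Ckg] := dg i; split=> [x Ux|].
    by apply: derivableD; [apply: derivableZ; exact: dfi|exact: dgi].
  apply: Ck_on_congr (IH _ _ Ckf Ckg) => // x Ux.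
  rewrite /partial [RHS]deriveD ?deriveZ//; [exact: dfi|exact: derivableZ (dfi _ Ux)|exact: dgi].
Qed.

Lemma Ck_on_mul k U f g : open U ->
  Ck_on k U f -> Ck_on k U g -> Ck_on k U (f \* g).
Proof.
move=> oU; elim: k f g => [|k IH] f g Cf Cg; move: (Cf) (Cg) => [cf df] [cg dg];
  (split; first by move=> x Ux; apply: continuousM; [exact: cf|exact: cg]) => // i.
have [dfi Ckf] := df i; have [dgi Ckg] := dg i; split=> [x Ux|].
    by apply: derivableM; [exact: dfi|exact: dgi].
  have C := IH _ _ (Ck_on_le Cf) Ckg; have D := IH _ _ (Ck_on_le Cg) Ckf.
  apply: Ck_on_congr (Ck_on_lin 1 oU C D) => // x Ux.
  rewrite /partial [RHS]deriveM; [|exact: dfi|exact: dgi].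
  by rewrite /= scale1r.
Qed.

Lemma Ck_on_cst k U (a : R) : open U -> Ck_on k U (fun=> a).
Proof.
move=> oU; elim: k a => [|k IH] a; 
  (split; first by move=> x _; exact: cst_continuous) => // i.
split=> [x _|]; first exact: derivable_cst.
by apply: Ck_on_congr (IH 0) => // x Ux; rewrite /partial derive_cst.
Qed.
End SmoothEuclideanTheory.

Record chart (R : realType) (n : nat) (M : topologicalType) := Chart {
  cdom : set M;
  cimg : set 'rV[R]_n;
  cmap : M -> 'rV[R]_n;
  cinv : 'rV[R]_n -> M;
  cdom_open : open cdom;
  cimg_open : open cimg;
  cmap_img : forall x, cdom x -> cimg (cmap x);
  cinv_dom : forall y, cimg y -> cdom (cinv y);
  cmapK : forall x, cdom x -> cinv (cmap x) = x;
  cinvK : forall y, cimg y -> cmap (cinv y) = y;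
  cmap_cont : forall x, cdom x -> {for x, continuous cmap};
  cinv_cont : forall y, cimg y -> {for y, continuous cinv}
}.

Record smooth_manifold (R : realType) (n : nat) := SmoothManifold {
  carrier :> topologicalType;
  man_hausdorff : hausdorff_space carrier;
  man_connected : connected [set: carrier];
  man_countable : @second_countable carrier;
  atlas : set (chart R n carrier);
  atlas_cover : forall x, exists2 c, atlas c & cdom c x;
  atlas_compat : forall c d, atlas c -> atlas d -> forall i,
    Cinfty_on (cmap c @` (cdom c `&` cdom d)) (fun y => cmap d (cinv c y) 0 i)
}.

Section TangentSpace.
Context {R : realType} {n : nat} (M : smooth_manifold R n).

(* [U] is an open subset of [M]; [f] is only relevant on [U]. *)
Definition smooth_on (U : set M) (f : M -> R) : Prop :=
  forall c, atlas c -> Cinfty_on (cmap c @` (cdom c `&` U)) (f \o cinv c).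

Definition smooth (f : M -> R) : Prop := smooth_on setT f.

Lemma chart_image_open (c : chart R n M) : open (cmap c @` (cdom c `&` setT)).
Proof.
rewrite setIT [X in open X](_ : _ = cimg c); first exact: cimg_open.
apply/seteqP; split=> [_ [x cx <-]|y cy]; first exact: cmap_img.
by exists (cinv c y); [exact: cinv_dom|exact: cinvK].
Qed.

Lemma smooth_lin (a : R) (f g : M -> R) : smooth f -> smooth g -> smooth (a \*: f \+ g).
Proof.
move=> sf sg c ac k.
exact: (@Ck_on_lin _ _ k _ a (f \o cinv c) (g \o cinv c) (@chart_image_open c) (sf c ac k) (sg c ac k)).
Qed.

Lemma smooth_mul (f g : M -> R) : smooth f -> smooth g -> smooth (f \* g).
Proof.
move=> sf sg c ac k.
exact: (@Ck_on_mul _ _ k _ (f \o cinv c) (g \o cinv c) (@chart_image_open c) (sf c ac k) (sg c ac k)).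
Qed.

Lemma smooth_cst (a : R) : smooth (fun _ : M => a).
Proof. by move=> c ac k; exact: Ck_on_cst (@chart_image_open c). Qed.

(* Tangent vectors at [x] are the derivations at [x] of the algebra of smooth
   functions. They are extended by 0 to the functions that are not smooth, so
   that Leibniz equality is equality of derivations. *)
Definition derivation_at (x : M) (v : (M -> R) -> R) : Prop :=
  [/\ forall a f g, smooth f -> smooth g -> v (a \*: f \+ g) = a * v f + v g,
      forall f g, smooth f -> smooth g -> v (f \* g) = f x * v g + g x * v f
    & forall f, ~ smooth f -> v f = 0].

Definition derivations (x : M) : {pred ((M -> R) -> R)} :=
  fun v => `[< derivation_at x v >].

Fact derivations_submod_closed x : submod_closed (derivations x).
Proof.
split=> [|a v w /asboolP[v1 v2 v3] /asboolP[w1 w2 w3]]; apply/asboolP.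
  by split=> [a f g _ _|f g _ _|//]; rewrite /GRing.zero /= ?mulr0 ?addr0.
have E f : (a *: v + w) f = a * v f + w f by [].
split=> [b f g sf sg|f g sf sg|f sf]; rewrite !E.
- by rewrite v1// w1// !mulrDr (mulrCA a) addrACA.
- by rewrite v2// w2// !mulrDr !(mulrCA a) addrACA.
- by rewrite v3// w3// mulr0 addr0.
Qed.
HB.instance Definition _ x :=
  GRing.isSubmodClosed.Build R ((M -> R) -> R) (derivations x)
    (derivations_submod_closed x).

Record tangent (x : M) := Tangent {
  tval :> (M -> R) -> R;
  tvalP : tval \in derivations x
}.
HB.instance Definition _ x := [isSub for @tval x].
HB.instance Definition _ x := [Choice of tangent x by <:].
HB.instance Definition _ x := [SubChoice_isSubLmodule of tangent x by <:].

Definition field := forall x : M, tangent x.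

Definition apply_field (V : field) (f : M -> R) : M -> R := fun x => V x f.

Definition smooth_field (V : field) : Prop :=
  forall f, smooth f -> smooth (apply_field V f).

(* [insubd] returns its default value only when the commutator is not a
   derivation, which does not happen for smooth fields, see [bracketE]. *)
Definition bracket (V W : field) : field := fun x =>
  insubd (0 : tangent x)
    (fun f => V x (apply_field W f) - W x (apply_field V f)).

Lemma bracket_derivation (V W : field) (x : M) : smooth_field V -> smooth_field W ->
  derivation_at x (fun f => V x (apply_field W f) - W x (apply_field V f)).
Proof.
move=> sV sW.
have P (X : field) y : derivation_at y (X y) by apply/asboolP; exact: tvalP.
have lin (X : field) a f g : smooth f -> smooth g ->
    apply_field X (a \*: f \+ g) = a \*: apply_field X f \+ apply_field X g.
  by move=> sf sg; apply/funext => y; have [+ _ _] := P X y; exact.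
have mul (X : field) f g : smooth f -> smooth g ->
    apply_field X (f \* g) =
    1 \*: (f \* apply_field X g) \+ (g \* apply_field X f).
  move=> sf sg; apply/funext => y; have [_ + _] := P X y.
  by rewrite /apply_field /= scale1r; exact.
have [Vl Vm _] := P V x; have [Wl Wm _] := P W x.
split=> [a f g sf sg|f g sf sg|f sf].
- rewrite !lin // Vl ?Wl; [|exact: sV|exact: sV|exact: sW|exact: sW].
  by rewrite mulrBr opprD addrACA.
- rewrite !mul // Vl ?Wl; try by apply: smooth_mul => //; (apply: sV || apply: sW).
  rewrite !Vm ?Wm //; try by (apply: sV || apply: sW).
  rewrite !mul1r /apply_field !mulrBr.
  set a := V x g; set b := V x f; set c := W x g; set d := W x f.
  ring.
- have E (X : field) : apply_field X f = fun=> 0.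
    by apply/funext => y; have [_ _ H] := P X y; exact: H.
  have Z v : derivation_at x v -> v (fun=> 0) = 0.
    have z : (-1 : R) \*: (fun=> 0 : R) \+ (fun=> 0) = (fun=> 0) :> (M -> R).
      by apply/funext => y; rewrite /= addr0 -[LHS]/(-1 * 0) mulr0.
    move=> [l _ _]; have := l (-1) _ _ (smooth_cst 0) (smooth_cst 0).
    by rewrite z mulN1r addNr.
  by rewrite !E !Z ?subrr //; exact: P.
Qed.

Lemma bracketE (V W : field) (x : M) (f : M -> R) :
  smooth_field V -> smooth_field W ->
  bracket V W x f = V x (apply_field W f) - W x (apply_field V f).
Proof.
move=> sV sW; rewrite /bracket -[tval _]/(val _) insubdK //.
by apply/asboolP; exact: bracket_derivation.
Qed.

Definition one_form (t : forall x, tangent x -> R) : Prop :=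
  (forall x, scalar (t x)) /\
  (forall V, smooth_field V -> smooth (fun x => t x (V x))).

End TangentSpace.

Record local_frame (R : realType) (M : topologicalType) (E : M -> lmodType R)
    (k : nat) := LocalFrame {
  fdom : set M;
  fvec : 'I_k -> forall x, E x
}.

(* A vector bundle is given by its fibres and by the local frames that
   correspond to the local trivializations of a bundle atlas. *)
Record vector_bundle (R : realType) (n : nat) (M : smooth_manifold R n)
    (k : nat) := VectorBundle {
  fiber :> M -> lmodType R;
  frames : set (local_frame fiber k);
  frame_open : forall F, frames F -> open (fdom F);
  frame_cover : forall x, exists2 F, frames F & fdom F x;
  frame_basis : forall F x, frames F -> fdom F x -> is_basis ((fvec F)^~ x);
  frame_transition : forall F G, frames F -> frames G ->
    exists a : 'I_k -> 'I_k -> M -> R,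
      (forall i j, smooth_on (fdom F `&` fdom G) (a i j)) /\
      (forall x i, fdom F x -> fdom G x ->
         fvec F i x = \sum_j a i j x *: fvec G j x)
}.

Section Connections.
Context {R : realType} {n : nat} {M : smooth_manifold R n} {k : nat}.
Variable E : vector_bundle M k.

Definition section := forall x, E x.

Definition smooth_section (s : section) : Prop :=
  forall F, frames F -> exists a : 'I_k -> M -> R,
    (forall i, smooth_on (fdom F) (a i)) /\
    (forall x, fdom F x -> s x = \sum_i a i x *: fvec F i x).

(* [cov D v s] is the covariant derivative of [s] in the direction of the
   tangent vector [v]; only its values on smooth sections are relevant. *)
Record connection := Connection {
  cov : forall x, tangent x -> section -> E x;
  cov_linear : forall x s, smooth_section s -> linear (fun v => @cov x v s);
  cov_add : forall x (v : tangent x) s t, smooth_section s -> smooth_section t ->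
    cov v (fun y => s y + t y) = cov v s + cov v t;
  cov_leibniz : forall x (v : tangent x) f s, smooth f -> smooth_section s ->
    cov v (fun y => f y *: s y) = v f *: s x + f x *: cov v s;
  cov_smooth : forall V s, smooth_field V -> smooth_section s ->
    smooth_section (fun x => cov (V x) s)
}.

Definition curvature (D : connection) (V W : field M) (s : section) : section :=
  fun x => cov D (V x) (fun y => cov D (W y) s)
         - cov D (W x) (fun y => cov D (V y) s)
         - cov D (bracket V W x) s.

End Connections.

Record lightlike_manifold (R : realType) (m : nat) := LightlikeManifold {
  base :> smooth_manifold R m.+1;
  hN : forall x : base, tangent x -> tangent x -> R;
  ZN : field base;
  hN_bilinear : forall x, bilinear_form (@hN x);
  hN_sym : forall x, symmetric_form (@hN x);
  hN_ge0 : forall x (v : tangent x), 0 <= hN v v;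
  hN_smooth : forall V W, smooth_field V -> smooth_field W ->
    smooth (fun x => hN (V x) (W x));
  ZN_smooth : smooth_field ZN;
  ZN_neq0 : forall x, ZN x != 0;
  ZN_span : forall x (v : tangent x),
    (forall w, hN v w = 0) <-> (exists a, v = a *: ZN x)
}.
Arguments ZN {R m} l x : rename.

Section Radical.
Context {R : realType} {m : nat} (N : lightlike_manifold R m).

Definition Rad (x : N) : {pred tangent x} := fun v => `[< forall w, hN v w = 0 >].

Fact Rad_submod_closed x : submod_closed (@Rad x).
Proof.
have [hl _] := hN_bilinear x.
split=> [|a v w /asboolP v0 /asboolP w0]; apply/asboolP => u.
  by have := hl u (-1) 0 0; rewrite scaler0 addr0 mulN1r addNr.
by rewrite (hl u a v w) v0 w0 mulr0 addr0.
Qed.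
HB.instance Definition _ x :=
  GRing.isSubmodClosed.Build R (tangent x) (@Rad x) (Rad_submod_closed x).

Definition EN (x : N) : lmodType R := lmod_quot (@Rad x).

Definition cls (x : N) (v : tangent x) : EN x := lmod_class (@Rad x) v.

Definition transverse_form (t : forall x : N, tangent x -> R) : Prop :=
  one_form t /\ forall x, t x (ZN N x) = 1.

Definition An_section (t : forall x : N, tangent x -> R) (X : field N) : Prop :=
  smooth_field X /\ forall x, t x (X x) = 0.

(* A local orthonormal frame of An(t) over the open set [U], presented as the
   restriction to [U] of global sections; up to shrinking the domain around a
   point, every local orthonormal frame has this form. *)
Definition orthonormal_frame (t : forall x : N, tangent x -> R) (U : set N)
    (E : 'I_m -> field N) : Prop :=
  [/\ open U, forall i, An_section t (E i)
    & forall x i j, U x -> hN (E i x) (E j x) = (i == j)%:R].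

End Radical.

Record lightlike_extension (R : realType) (m : nat)
    (M : smooth_manifold R m.+1) := LightlikeExtension {
  bun : vector_bundle M m.+2;
  hT : forall x, bun x -> bun x -> R;
  nab : connection bun;
  xi : section bun;
  hT_bilinear : forall x, bilinear_form (@hT x);
  hT_sym : forall x, symmetric_form (@hT x);
  hT_lorentzian : forall x, lorentzian m.+1 (@hT x);
  hT_smooth : forall s t, smooth_section s -> smooth_section t ->
    smooth (fun x => hT (s x) (t x));
  nab_metric : forall x (v : tangent x) s t,
    smooth_section s -> smooth_section t ->
    v (fun y => hT (s y) (t y)) = hT (cov nab v s) (t x) + hT (s x) (cov nab v t);
  xi_smooth : smooth_section xi;
  xi_lightlike : forall x, lightlike (@hT x) (xi x);
  xi_mono : forall x, injective (fun v : tangent x => cov nab v xi)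
}.
Arguments xi {R m M} l x : rename.

Section Extension.
Context {R : realType} {m : nat} {N : lightlike_manifold R m}.
Variable T : lightlike_extension N.
Implicit Types (x : N) (V W X Y : field N) (t : forall x : N, tangent x -> R).

Definition Phi x (v : tangent x) : bun T x := cov (nab T) v (xi T).

Definition PhiS W : section (bun T) := fun x => Phi (W x).

Definition Phi_inv x (s : bun T x) : tangent x := xget 0 [set v | Phi v = s].

Definition extension_for : Prop :=
  (forall x (v w : tangent x), hN v w = hT (Phi v) (Phi w)) /\
  (forall x, Phi (ZN N x) = xi T x).

Definition RT V W (s : section (bun T)) : section (bun T) :=
  curvature (nab T) V W s.

Definition collinear_xi (s : section (bun T)) : Prop :=
  exists f : N -> R, forall x, s x = f x *: xi T x.

(* [weyl a b c] is the class of Phi^-1 (R^T(U,V) Phi(W)) at [x] for any smooth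
   fields U, V, W whose values at [x] represent [a], [b], [c]. *)
Definition weyl x (a b c : EN x) : EN x :=
  xget 0 [set d | exists U V W,
    [/\ smooth_field U, smooth_field V & smooth_field W] /\
    [/\ cls (U x) = a, cls (V x) = b, cls (W x) = c &
        d = cls (Phi_inv (RT U V (PhiS W) x))]].

(* The conditions determine eta^t at each point, and the resulting section is
   smooth for every transverse form t. *)
Definition eta t : section (bun T) := fun x =>
  xget 0 [set e | [/\ lightlike (@hT _ _ _ T x) e, hT (xi T x) e = 1
    & forall v : tangent x, t x v = 0 -> hT (Phi v) e = 0]].

(* The An(t)-component of [s] in the splitting R xi + Phi(An t) + R eta^t. *)
Definition An_comp t x (s : bun T x) : tangent x :=
  xget 0 [set X | t x X = 0 /\
    exists a b, s = a *: xi T x + Phi X + b *: eta t x].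

Definition nabla_An t x (v : tangent x) X : tangent x :=
  An_comp t (cov (nab T) v (PhiS X)).

Definition D_An t x (v : tangent x) : tangent x :=
  An_comp t (cov (nab T) v (eta t)).

Definition R_An t V W X : field N := fun x =>
  nabla_An t (V x) (fun y => nabla_An t (W y) X)
  - nabla_An t (W x) (fun y => nabla_An t (V y) X)
  - nabla_An t (bracket V W x) X.

Definition Ric_An t (E : 'I_m -> field N) X Y : N -> R := fun x =>
  \sum_i hN (R_An t (E i) X Y x) (E i x).

Definition S_An t (E : 'I_m -> field N) : N -> R := fun x =>
  \sum_i Ric_An t E (E i) (E i) x.

End Extension.

(* Main.v *)
Require Import Defs.
From HB Require Import structures.
From mathcomp Require Import all_boot all_order all_algebra.
From mathcomp Require Import ring.
From mathcomp Require Import all_classical all_reals all_analysis.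
Import numFieldNormedType.Exports.
Import Order.TTheory GRing.Theory Num.Theory.
Set Implicit Arguments.
Unset Strict Implicit.
Unset Printing Implicit Defensive.
Local Open Scope classical_set_scope.
Local Open Scope ring_scope.

(* Split T as R xi + Phi(An t) + R eta^t. The An(t)-component of the curvature of
   T on Phi(An t) is then R^t plus terms bilinear in h and D^t, and contracting it
   over an orthonormal frame E of An(t) gives
     sum_i h(R^T(E_i, V) Phi(W), Phi(E_i))
       = Ric^t(V, W) - (m - 2) h(D^t V, W) - tr(D^t) h(V, W).
   By the collinearity hypotheses the left-hand side depends only on the classes
   of V and W and is the trace of [U] |-> W([U], [V])[W]; so the trace vanishes iff
   D^t is the Schouten-type tensor, where tr(D^t) = S^t / (2 (m - 1)) is found by
   contracting once more.

   The pointwise meaning of this identity rests on global objects: a transverse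
   form, and orthonormal frames of An(t) around each point by Gram-Schmidt. Both
   come from smooth bump functions and the coordinate fields of a chart. *)

(** * Smooth functions on Euclidean space *)

(** A connection is meaningful only on globally smooth sections, and [weyl] and [orthonormal_frame]
    quantify over global fields, so nothing can be computed inside a chart alone: local data are
    multiplied by a cutoff and extended to [N], and values at a point are recovered from the
    linearity of the curvature over smooth functions. The implication from (2) to (1) would be empty
    if [N] carried no transverse form. One is obtained by pairing [Phi] with a section [S] such that
    h(xi, S) = 1. Such sections exist locally by nondegeneracy of the metric; gluing them is where
    second countability enters. The factor 2 (m - 1) is (m - 2) + m: contracting (m - 2) h(D V, W)
    gives (m - 2) tr(D), and contracting tr(D) h(V, W) gives m tr(D). Conversely, tracing the
    Schouten formula returns the same value of tr(D), because 2 (m - 1) - m = m - 2. The bound m >=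
    3 makes m - 2 invertible. *)

Section Euclidean.
Context {R : realType} {n : nat}.
Implicit Types (U V : set 'rV[R]_n) (f g : 'rV[R]_n -> R).

Lemma Ck_on_subset k U V f : V `<=` U -> Ck_on k U f -> Ck_on k V f.
Proof.
move=> VU; elim: k f => [|k IH] f [cf df]; (split; first by move=> x /VU; exact: cf) => // i.
by have [di Ci] := df i; split; [move=> x /VU; exact: di|exact: IH].
Qed.

(** [Ck_on] tests points of [U] but takes its limits in the whole space, so the sets [V] need not be
    open. *)
Lemma Ck_on_local k U f :
  (forall x, U x -> exists2 V, V x & Ck_on k V f) -> Ck_on k U f.
Proof.
elim: k f => [|k IH] f lf.
  by split=> // x /lf[V Vx [+ _]]; exact.
split=> [x /lf[V Vx [+ _]]|i]; first exact.
split=> [x /lf[V Vx [_ /(_ i)[+ _]]]|]; first exact.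
by apply: IH => x /lf[V Vx [_ /(_ i)[_ ?]]]; exists V.
Qed.

Lemma rV_coord_le_norm (h : 'rV[R]_n) i : `|h 0 i| <= `|h|.
Proof.
rewrite [leRHS]/Num.Def.normr/= mx_normrE.
exact: (le_bigmax _ (fun ij : 'I_1 * 'I_n => `|h ij.1 ij.2|) (0, i)).
Qed.

Lemma derivable_lineP f (x v : 'rV[R]_n) (s : R) :
  derivable f (x + s *: v) v ->
  is_derive s 1 (fun r => f (x + r *: v)) ('D_v f (x + s *: v)).
Proof.
move=> df; have E (h : R) : h *: (1 : R) = h by exact: mulr1.
have Q : (fun h : R => h^-1 *: (((fun r : R => f (x + r *: v)) \o shift s) (h *: (1 : R)) - f (x + s *: v)))
   = (fun h : R => h^-1 *: ((f \o shift (x + s *: v)) (h *: v) - f (x + s *: v))).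
  by apply/funext => h /=; rewrite E scalerDl addrCA.
by split; rewrite /derivable /derive Q.
Qed.

(** The segment is parametrised by [s] in [0, 1], which spares a case distinction on the sign of
    [t]. *)
Lemma line_mvt f (x v : 'rV[R]_n) (t : R) :
  (forall s : R, 0 <= s <= 1 -> derivable f (x + (s * t) *: v) v) ->
  exists2 s : R, 0 <= s <= 1 & f (x + t *: v) - f x = t * 'D_v f (x + (s * t) *: v).
Proof.
move=> df.
have D (s : R) : 0 <= s <= 1 ->
    is_derive s 1 (fun r => f (x + (r * t) *: v)) (t * 'D_v f (x + (s * t) *: v)).
  move=> s01; have := derivable_lineP (df s s01).
  have D2 : is_derive s 1 (fun r : R => r * t) t.
    have -> : (fun r : R => r * t) = (t \*: (@id R)).
      by apply/funext => r /=; rewrite mulrC.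
    by apply: is_derive_eq; rewrite /GRing.scale /= mulr1.
  move=> D1; have := @is_derive1_comp R (fun r => f (x + r *: v)) (fun r => r * t) s _ _ D1 D2.
  by rewrite mulrC.
have [||s] := @MVT_segment R (fun r => f (x + (r * t) *: v)) (fun s => t * 'D_v f (x + (s * t) *: v)) 0 1 ler01.
- by move=> s; rewrite in_itv /= => /andP[s0 s1]; apply: D; rewrite !ltW.
- apply: derivable_within_continuous => s; rewrite in_itv /= => s01.
  by have [] := D s s01.
rewrite in_itv /= => s01; rewrite subr0 mulr1 mul1r mul0r scale0r addr0 => ->.
by exists s.
Qed.

(** The increment of [f] is split along a staircase with one coordinate step at a time; on each step
    the mean value theorem replaces the increment by a partial derivative at a nearby point. *)
Lemma continuous_partials_differentiable U f y : open U -> U y ->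
  (forall i x, U x -> derivable f x (delta_mx 0 i)) ->
  (forall i, {for y, continuous (partial i f)}) -> differentiable f y.
Proof.
move=> oU Uy df cf.
pose L (h : 'rV[R]_n) : R := \sum_i h 0 i * partial i f y.
have Ll : linear L.
  move=> a u v; rewrite /L scaler_sumr -big_split; apply: eq_bigr => i _ /=.
  by rewrite !mxE mulrDl -mulrA.
pose LM := GRing.isLinear.Build _ _ _ _ _ Ll.
pose LL : {linear 'rV[R]_n -> R} := HB.pack L LM.
have Lc : continuous LL.
  rewrite (_ : (LL : _ -> _) = \sum_i (fun h : 'rV[R]_n => h 0 i * partial i f y)); last first.
    by apply/funext => h; rewrite fct_sumE.
  elim/big_ind: _ => [|F G cF cG|i _] h; first exact: cst_continuous.
    by apply: continuousD; [exact: cF|exact: cG].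
  by apply: (@continuousM R _ (fun h : 'rV[R]_n => h 0 i) (cst (partial i f y))); [exact: coord_continuous|exact: cst_continuous].
suff E : f \o shift y = cst (f y) + (LL : 'rV[R]_n -> R) +o_ (0 : 'rV[R]_n) id.
  by apply/diff_locallyP; rewrite (@diff_unique R _ R f LL y Lc E); split.
apply/eqaddoP => e e0.
(* There are [n] steps, each with error at most d |h|; the successor keeps the denominator nonzero
   when n = 0. *)
pose d := e / n.+1%:R.
have d0 : 0 < d by rewrite divr_gt0.
have [r r0 Hr] : exists2 r : R, 0 < r & forall z : 'rV[R]_n, (forall i, `|z 0 i - y 0 i| < r) ->
    U z /\ forall i, `|partial i f z - partial i f y| <= d.
  have : \forall z \near y, U z /\ forall i, `|partial i f z - partial i f y| <= d.
    apply: filterI; first exact: open_nbhs_nbhs.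
    apply: (@filter_forall _ _ (fun i (z : 'rV[R]_n) => `|partial i f z - partial i f y| <= d) (nbhs y) _) => i; have /cvgrPdist_le/(_ d d0) := cf i.
    by apply: filterS => z; rewrite distrC.
  move=> /nbhs_ballP[r r0 Hr]; exists r => // z zr; apply: Hr.
  by split=> // i0 j; rewrite ord1 -ball_normE /ball_ /= distrC.
near=> h.
have hr i : `|h 0 i| < r.
  by apply: (le_lt_trans (rV_coord_le_norm _ _)); near: h; exact: (@nbhs0_lt R 'rV[R]_n r r0).
(* The corners of the staircase from [y] to y + h: the first [k] coordinates have already moved. *)
pose z k := y + \row_i (if (i < k)%N then h 0 i else 0).
have zE : y + h = z n by rewrite /z; congr (_ + _); apply/rowP => i; rewrite mxE ltn_ord.
rewrite /= !fctE /= /L.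
have -> : h + y = z n by rewrite addrC.
have incr (i : 'I_n) : `|f (z i.+1) - f (z i) - h 0 i * partial i f y| <= d * `|h|.
  have zS : z i.+1 = z i + h 0 i *: delta_mx 0 i.
    rewrite /z -addrA; congr (_ + _); apply/rowP => j; rewrite !mxE eqxx /= ltnS leq_eqVlt.
    rewrite -val_eqE /=; case: eqP => [/val_inj ->|_] /=; first by rewrite ltnn add0r mulr1.
    by rewrite mulr0 addr0.
  have zr (s : R) : 0 <= s <= 1 -> forall j, `|(z i + (s * h 0 i) *: delta_mx 0 i) 0 j - y 0 j| < r.
    move=> /andP[s0 s1] j; rewrite !mxE eqxx /=.
    have E3 (a b c : R) : a + b + c - a = b + c by ring.
    rewrite E3.
    case: (ltnP j i) => ji.
      by rewrite -val_eqE /= (ltn_eqF ji) mulr0 addr0.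
    rewrite add0r; case: eqP => _; rewrite ?mulr0 ?normr0// ?mulr1.
    by rewrite normrM (ger0_norm s0) (le_lt_trans _ (hr i))// ler_piMl.
  have [s s01 ->] : exists2 s : R, 0 <= s <= 1 & f (z i.+1) - f (z i) = h 0 i * partial i f (z i + (s * h 0 i) *: delta_mx 0 i).
    rewrite zS; apply: line_mvt => s s01; apply: df.
    by have [] := Hr _ (zr s s01).
  rewrite -mulrBr normrM mulrC ler_pM//.
    by have [_] := Hr _ (zr s s01); exact.
  exact: rV_coord_le_norm.
have -> : f (z n) - (f y + \sum_i h 0 i * partial i f y) = \sum_(i < n) (f (z i.+1) - f (z i) - h 0 i * partial i f y).
  rewrite sumrB opprD addrA; congr (_ - _).
  have -> : y = z 0%N by rewrite /z; rewrite [X in _ + X](_ : _ = 0) ?addr0//; apply/rowP => i; rewrite !mxE.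
  by rewrite -(telescope_sumr (fun k => f (z k))) // big_mkord.
apply: le_trans (ler_norm_sum _ _ _) _.
apply: le_trans (ler_sum _ (fun i _ => incr i)) _.
rewrite sumr_const card_ord -mulr_natl mulrA ler_wpM2r// /d mulrA.
rewrite ler_pdivrMr// mulrC ler_wpM2l ?ler_nat//. exact: ltW.
Unshelve. all: by end_near. Qed.

Lemma differentiable_derive_sum f y (v : 'rV[R]_n) : differentiable f y ->
  'D_v f y = \sum_i v 0 i * partial i f y.
Proof.
move=> df; rewrite deriveE// {1}[v]row_sum_delta linear_sum; apply: eq_bigr => i _.
by rewrite linearZ /= /partial deriveE.
Qed.

Lemma Ck_on_differentiable k U f y : open U -> U y -> Ck_on k.+1 U f -> differentiable f y.
Proof.
move=> oU Uy [_ df]; apply: (continuous_partials_differentiable oU Uy).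
  by move=> i x; have [+ _] := df i; exact.
by move=> i; have [_] := df i; case: k {df} => [|k] [c _]; exact: c _ Uy.
Qed.
End Euclidean.

(** * The chain rule for maps of class C^k *)

Section Composition.
Context {R : realType} {n p : nat}.
Implicit Types (U : set 'rV[R]_n) (V : set 'rV[R]_p).

Lemma Ck_on_sum k U (I : Type) (r : seq I) (F : I -> 'rV[R]_n -> R) : open U ->
  (forall i, Ck_on k U (F i)) -> Ck_on k U (fun x => \sum_(i <- r) F i x).
Proof.
move=> oU CF; elim: r => [|i r IH].
  by apply: Ck_on_congr (Ck_on_cst k 0 oU) => // x _; rewrite big_nil.
apply: Ck_on_congr (Ck_on_lin 1 oU (CF i) IH) => // x _.
by rewrite big_cons /= scale1r.
Qed.

Lemma rV_continuous (h : 'rV[R]_n -> 'rV[R]_p) (x : 'rV[R]_n) :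
  (forall j, {for x, continuous (fun y => h y 0 j)}) -> {for x, continuous h}.
Proof.
move=> ch; apply/(@cvgrPdist_le _ _ _ (nbhs x) (nbhs_filter x)) => e e0; near=> y.
rewrite [leLHS]/Num.Def.normr/= mx_normrE; apply: bigmax_le => [|[i j] _] /=; first exact: ltW.
rewrite ord1 !mxE; move: j; near: y; apply: (@filter_forall _ _ (fun j (y : 'rV[R]_n) => `|h x 0 j - h y 0 j| <= e) (nbhs x) _) => j.
by have /cvgrPdist_le/(_ e e0) := ch j.
Unshelve. all: by end_near. Qed.

Lemma rV_differentiable (h : 'rV[R]_n -> 'rV[R]_p) x :
  (forall j, differentiable (fun y => h y 0 j) x) -> differentiable h x.
Proof.
move=> dh; rewrite (_ : h = \sum_j (fun y => h y 0 j *: delta_mx 0 j)).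
  by apply: differentiable_sum => j; exact: differentiableZl.
by apply/funext => y; rewrite fct_sumE [LHS]row_sum_delta.
Qed.

(** Induction on [k]: a partial derivative of the composite is a sum of products of a partial of [h]
    with a partial of [g] composed with [h], and the latter factor falls under the induction
    hypothesis. *)
Lemma Ck_on_comp k U V (h : 'rV[R]_n -> 'rV[R]_p) (g : 'rV[R]_p -> R) :
  open U -> open V -> (forall x, U x -> V (h x)) ->
  (forall j, Ck_on k U (fun x => h x 0 j)) -> Ck_on k V g -> Ck_on k U (g \o h).
Proof.
move=> oU oV hUV; elim: k g => [|k IH] g Ch Cg.
  split=> // x Ux; apply: continuous_comp; last by have [+ _] := Cg; apply; exact: hUV.
  by apply: rV_continuous => j; have [+ _] := Ch j; exact.
have dh x : U x -> differentiable h x.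
  by move=> Ux; apply: rV_differentiable => j; exact: Ck_on_differentiable (Ch j).
have dg x : U x -> differentiable g (h x).
  by move=> Ux; exact: Ck_on_differentiable oV (hUV _ Ux) Cg.
split=> [x Ux|i].
  by apply: continuous_comp; apply: differentiable_continuous; [exact: dh|exact: dg].
split=> [x Ux|]; first by apply/diff_derivable/differentiable_comp; [exact: dh|exact: dg].
have C : Ck_on k U (fun x => \sum_j (partial i (fun y => h y 0 j) x * (partial j g \o h) x)).
  apply: Ck_on_sum => // j; apply: Ck_on_mul => //; first by have [_ /(_ i)[]] := Ch j.
  by apply: IH => [l|]; [exact: Ck_on_le|have [_ /(_ j)[]] := Cg].
apply: Ck_on_congr C => // x Ux; rewrite [RHS]/partial deriveE; last by apply/differentiable_comp; [exact: dh|exact: dg].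
rewrite diff_comp; [|exact: dh|exact: dg].
rewrite /= -deriveE; last exact: dg.
rewrite differentiable_derive_sum; last exact: dg.
apply: eq_bigr => j _; congr (_ * _).
rewrite -deriveE; last exact: dh.
rewrite derive_mx ?mxE//; apply: diff_derivable; exact: dh.
Qed.

End Composition.

(** * Smooth functions of one real variable: powers and the smooth step *)

Section OneVariable.
Context {R : realType} {n : nat}.
Implicit Types (D : set R) (phi psi : R -> R).

(** The derivative is a witness constrained on [D] only, so closed formulas can serve as derivatives
    whatever their values off [D]. *)
Fixpoint Ck1 (k : nat) D phi : Prop :=
  if k is k'.+1 then
    exists2 phi', (forall x, D x -> is_derive x (1 : R) phi (phi' x)) & Ck1 k' D phi'
  else forall x, D x -> {for x, continuous phi}.

Lemma Ck1_lin k D a phi psi : Ck1 k D phi -> Ck1 k D psi -> Ck1 k D (a \*: phi \+ psi).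
Proof.
elim: k phi psi => [|k IH] phi psi /=.
  by move=> cf cg x Dx; apply: continuousD; [apply: continuousZr; exact: cf|exact: cg].
move=> [f df Cf] [g dg Cg]; exists (a \*: f \+ g); last exact: IH.
by move=> x Dx; have := df _ Dx; have := dg _ Dx => ? ?; apply: is_deriveD.
Qed.

Lemma Ck_on_comp1 k U D phi (f : 'rV[R]_n -> R) : open U ->
  (forall x, U x -> D (f x)) -> Ck1 k D phi -> Ck_on k U f -> Ck_on k U (phi \o f).
Proof.
move=> oU fUD; elim: k phi => [|k IH] phi.
  by move=> cp [cf _]; split=> // x Ux; apply: continuous_comp; [exact: cf|exact: cp (fUD _ Ux)].
move=> [phi' dphi Cphi'] Cf.
have df x : U x -> differentiable f x by move=> Ux; exact: Ck_on_differentiable Cf.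
have dp x : U x -> differentiable phi (f x).
  by move=> Ux; apply/derivable1_diffP; have [] := dphi _ (fUD _ Ux).
split=> [x Ux|i].
  by apply: continuous_comp; apply: differentiable_continuous; [exact: df|exact: dp].
split=> [x Ux|]; first by apply/diff_derivable/differentiable_comp; [exact: df|exact: dp].
have C1 := IH _ Cphi' (Ck_on_le Cf).
have C2 : Ck_on k U (partial i f) by have [_ /(_ i)[]] := Cf.
apply: Ck_on_congr (Ck_on_mul oU C1 C2) => // x Ux.
rewrite [RHS]/partial deriveE; last by apply/differentiable_comp; [exact: df|exact: dp].
rewrite diff_comp; [|exact: df|exact: dp].
rewrite /= diff1E; last exact: dp.
rewrite -deriveE; last exact: df.
rewrite derive1E mulrC; congr (_ * _).
by have [_ ->] := dphi _ (fUD _ Ux).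
Qed.

Lemma Ck1_powR k a : Ck1 k [set x | 0 < x] (fun x : R => x `^ a).
Proof.
elim: k a => [|k IH] a /=.
  move=> x x0; apply/differentiable_continuous/derivable1_diffP.
  by have [] := is_derive1_powR a x0.
exists (fun x => a * x `^ (a - 1)); first by move=> x x0; exact: is_derive1_powR.
(* The multiple a f is written as (a - 1) f + f to fit the shape of [Ck1_lin]. *)
have C := IH (a - 1); have := Ck1_lin (a - 1) C C.
by congr (Ck1 _ _ _); apply/funext => x /=; rewrite /GRing.scale /= mulrBl mul1r subrK.
Qed.

(* x^-k e^(-1/x), extended by zero: differentiating stays in the span of the family. *)
Definition flat (k : nat) (x : R) : R := if 0 < x then x ^- k * expR (- x^-1) else 0.

(** With y = 1 / x this is e^y >= y^(k+2) / (k+2)!. The exponent k + 2 leaves a factor x^2, enough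
    for the difference quotient at 0 to tend to 0. *)
Lemma flat_bound k (x : R) : 0 < x -> x ^- k * expR (- x^-1) <= k.+2`!%:R * x ^+ 2.
Proof.
move=> x0; have y0 : 0 < x^-1 by rewrite invr_gt0.
have E := expR_ge1Dxn k.+1 (ltW y0).
rewrite expRN -exprVn ler_pdivrMr ?expR_gt0//.
apply: le_trans (_ : k.+2`!%:R * x ^+ 2 * (1 + x^-1 ^+ k.+2 / k.+2`!%:R) <= _); last first.
  by rewrite ler_wpM2l// mulr_ge0 ?exprn_ge0 ?ltW.
rewrite mulrDr mulr1; set a := _ * x ^+ 2; apply: (@le_trans _ _ (a * (x^-1 ^+ k.+2 / k.+2`!%:R))).
  rewrite /a -addn2 exprD le_eqVlt; apply/orP; left; apply/eqP; field.
  by rewrite pnatr_eq0 -lt0n fact_gt0 gt_eqF.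
by rewrite lerDr /a mulr_ge0 ?exprn_ge0 ?ltW.
Qed.

Lemma flat0_le0 k x : x <= 0 -> flat k x = 0.
Proof. by rewrite /flat ltNge => ->. Qed.

Lemma is_derive_flat k (x : R) : is_derive x 1 (flat k) (flat k.+2 x - k%:R * flat k.+1 x).
Proof.
have [x0|x0|->] := ltgtP x 0.
- rewrite !flat0_le0 ?ltW// mulr0 subr0.
  apply: (@near_eq_is_derive _ _ _ (cst (0 : R)) (flat k) x 1 0).
  near=> y => /=; rewrite flat0_le0// ltW//; near: y; exact: lt_nbhsl.
(* For positive [x], [flat k] is [h] composed with the inverse, which avoids differentiating
   negative powers. *)
- pose h (y : R) := y ^+ k * expR (- y).
  have dh (y : R) : is_derive y 1 h (k%:R * y ^+ k.-1 * expR (- y) - y ^+ k * expR (- y)).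
    have D1 := is_deriveX k (is_derive_id y (1 : R)).
    have D2 := @is_derive1_comp R (@expR R) -%R y _ _ (is_derive_expR (- y)) (is_deriveNid y (1 : R)).
    have -> : h = (id ^+ k) * (@expR R \o -%R).
      by apply/funext => z; rewrite /h [RHS]/GRing.mul /= exprfctE.
    apply: is_derive_eq (is_deriveM D1 D2) _.
    rewrite /GRing.scale /= mulr1 mulrN1 mulrN addrC fctE; congr (_ - _); last exact: mulrC.
  have dV := @is_deriveV R id x 1 1 (lt0r_neq0 x0) (is_derive_id x (1 : R)).
  have D := @is_derive1_comp R h (fun y => y^-1) x _ _ (dh _) dV.
  apply: (@near_eq_is_derive _ _ _ (h \o (fun y => y^-1)) (flat k)).
    near=> y; rewrite /h /flat /= exprVn ifT//; near: y; exact: lt_nbhsr.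
  apply: is_derive_eq D _; rewrite /flat x0 /GRing.scale /=.
  by clear h dh; case: k => [|k] /=; rewrite -?exprVn !exprS ?expr0; field; rewrite gt_eqF.
- rewrite !flat0_le0// mulr0 subr0.
  have L : (fun h : R => h^-1 *: (flat k (h *: (1 : R) + 0) - flat k 0)) h @[h --> 0^'] --> (0 : R).
    apply/cvgrPdist_le => e e0; near=> h.
    have h0 : h != 0 by near: h; exact: nbhs_dnbhs_neq.
    rewrite sub0r normrN [_ *: 1]mulr1 addr0 (@flat0_le0 _ 0)// subr0 normrM normfV.
    have [hn|hp|h00] := ltgtP h 0; last by rewrite h00 eqxx in h0.
      by rewrite (flat0_le0 k (ltW hn)) normr0 mulr0; exact: ltW.
    rewrite ler_pdivrMl ?normr_gt0// (gtr0_norm hp).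
    have F : 0 <= flat k h by rewrite /flat hp mulr_ge0 ?expR_ge0// invr_ge0 exprn_ge0// ltW.
    rewrite (ger0_norm F) {1}/flat hp; apply: le_trans (flat_bound k hp) _.
    have c0 : 0 < (k.+2`!%:R : R) by rewrite ltr0n fact_gt0.
    rewrite expr2 mulrCA ler_pM2l// -ler_pdivlMl// mulrC; apply: ltW.
    rewrite -(gtr0_norm hp); near: h; apply: dnbhs0_lt.
    by rewrite divr_gt0.
  by split; [apply/cvg_ex; exists 0|apply: cvg_lim].
Unshelve. all: by end_near. Qed.

Lemma Ck1_flat k j : Ck1 k setT (flat j).
Proof.
elim: k j => [|k IH] j /=.
  move=> x _; apply/differentiable_continuous/derivable1_diffP.
  by have [] := is_derive_flat j x.
exists (fun x => flat j.+2 x - j%:R * flat j.+1 x); first by move=> x _; exact: is_derive_flat.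
have := Ck1_lin (- j%:R) (IH j.+1) (IH j.+2).
by congr (Ck1 _ _ _); apply/funext => x /=; rewrite /GRing.scale /= mulNr addrC.
Qed.

Lemma flat0_gt0 x : 0 < x -> 0 < flat 0 x.
Proof. by rewrite /flat => ->; rewrite expr0 invr1 mul1r expR_gt0. Qed.

(** The inner difference is flat 0 1 for x <= 0 and nonpositive for x >= 1. Only affine maps and
    compositions with [flat 0] occur, the divisor being constant, so smoothness needs no quotient of
    functions. *)
Definition smooth_step (x : R) : R := 1 - flat 0 (flat 0 1 - flat 0 x) / flat 0 (flat 0 1).

Lemma smooth_step_le0 x : x <= 0 -> smooth_step x = 0.
Proof.
by move=> x0; rewrite /smooth_step (@flat0_le0 _ x)// subr0 divff ?subrr// gt_eqF// !flat0_gt0.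
Qed.

Lemma smooth_step_ge1 x : 1 <= x -> smooth_step x = 1.
Proof.
move=> x1; rewrite /smooth_step (@flat0_le0 _ (_ - _)) ?mul0r ?subr0// subr_le0.
have x0 : 0 < x by exact: lt_le_trans x1.
rewrite /flat x0 ltr01 !expr0 !invr1 !mul1r ler_expR lerN2.
by rewrite invf_le1.
Qed.

Lemma Ck_on_smooth_step k U (f : 'rV[R]_n -> R) : open U -> Ck_on k U f -> Ck_on k U (smooth_step \o f).
Proof.
move=> oU Cf.
have C1 := Ck_on_comp1 oU (fun x _ => I) (Ck1_flat k 0) Cf.
have C2 := Ck_on_lin (-1) oU C1 (Ck_on_cst k (flat 0 1) oU).
have C3 := Ck_on_comp1 oU (fun x _ => I) (Ck1_flat k 0) C2.
apply: Ck_on_congr (Ck_on_lin (- (flat 0 (flat 0 1))^-1) oU C3 (Ck_on_cst k 1 oU)) => // x Ux /=.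
by rewrite /smooth_step /GRing.scale /= mulN1r mulNr mulrC addrC [- _ + _]addrC.
Qed.
End OneVariable.

(** * Smooth functions on a manifold *)

Section Manifold.
Context {R : realType} {n : nat} {M : smooth_manifold R n}.
Implicit Types (c d : chart R n M) (U V : set M) (f g : M -> R).

Lemma chart_image_openI c U : open U -> open (cmap c @` (cdom c `&` U)).
Proof.
move=> oU; rewrite openE => _ [x [cx Ux] <-]; rewrite /interior.
have cy := cmap_img cx.
have N1 : \forall z \near cmap c x, cimg c z.
  by apply: open_nbhs_nbhs; split=> //; exact: cimg_open.
have N2 : \forall z \near cmap c x, U (cinv c z).
  by apply: (cinv_cont cy); rewrite /= cmapK//; exact: open_nbhs_nbhs.
apply: filterS2 N1 N2 => z cz Uz; exists (cinv c z); last exact: cinvK.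
by split=> //; exact: cinv_dom.
Qed.

Lemma smooth_on_subset U V f : V `<=` U -> smooth_on U f -> smooth_on V f.
Proof.
move=> VU sf c ac k; apply: Ck_on_subset (sf c ac k).
by move=> _ [x [cx Vx] <-]; exists x => //; split=> //; exact: VU.
Qed.

Lemma smooth_on_local U f :
  (forall x, U x -> exists2 V, V x & smooth_on V f) -> smooth_on U f.
Proof.
move=> lf c ac k; apply: Ck_on_local => _ [x [cx Ux] <-].
have [V Vx sf] := lf x Ux; exists (cmap c @` (cdom c `&` V)); last exact: sf.
by exists x.
Qed.

Lemma smooth_on_congr U f g : open U -> (forall x, U x -> f x = g x) ->
  smooth_on U f -> smooth_on U g.
Proof.
move=> oU fg sf c ac k; apply: Ck_on_congr (sf c ac k); first exact: chart_image_openI.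
by move=> _ [x [cx Ux] <-] /=; rewrite cmapK// fg.
Qed.

Lemma smooth_on_lin U a f g : open U -> smooth_on U f -> smooth_on U g ->
  smooth_on U (a \*: f \+ g).
Proof.
move=> oU sf sg c ac k.
exact: (@Ck_on_lin _ _ k _ a (f \o cinv c) (g \o cinv c) (@chart_image_openI c _ oU) (sf c ac k) (sg c ac k)).
Qed.

Lemma smooth_on_mul U f g : open U -> smooth_on U f -> smooth_on U g ->
  smooth_on U (f \* g).
Proof.
move=> oU sf sg c ac k.
exact: (@Ck_on_mul _ _ k _ (f \o cinv c) (g \o cinv c) (@chart_image_openI c _ oU) (sf c ac k) (sg c ac k)).
Qed.

Lemma smooth_on_cst U a : open U -> smooth_on U (fun=> a).
Proof. by move=> oU c ac k; exact: (@Ck_on_cst _ _ k _ a (@chart_image_openI c _ oU)). Qed.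

Lemma smooth_on_sum U (I : Type) (r : seq I) (F : I -> M -> R) : open U ->
  (forall i, smooth_on U (F i)) -> smooth_on U (fun x => \sum_(i <- r) F i x).
Proof.
move=> oU sF c ac k.
exact: (@Ck_on_sum _ _ k _ _ r (fun i => F i \o cinv c) (@chart_image_openI c _ oU) (fun i => sF i c ac k)).
Qed.

Lemma smooth_on_smooth_step U f : open U -> smooth_on U f -> smooth_on U (smooth_step \o f).
Proof.
move=> oU sf c ac k; exact: (@Ck_on_smooth_step _ _ k _ (f \o cinv c) (@chart_image_openI c _ oU) (sf c ac k)).
Qed.

Lemma smooth_local f :
  (forall x, exists2 V, open V & V x /\ exists2 g, smooth g & forall y, V y -> f y = g y) ->
  smooth f.
Proof.
move=> lf; apply: smooth_on_local => x _; have [V oV [Vx [g sg fg]]] := lf x.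
exists V => //; apply: (@smooth_on_congr V g) => //; first by move=> y Vy; rewrite fg.
by apply: smooth_on_subset sg.
Qed.

Lemma smooth_sum (I : Type) (r : seq I) (F : I -> M -> R) :
  (forall i, smooth (F i)) -> smooth (fun x => \sum_(i <- r) F i x).
Proof. exact: smooth_on_sum openT. Qed.

Lemma smooth_powR f a : smooth f -> (forall x, 0 < f x) -> smooth (fun x => f x `^ a).
Proof.
move=> sf f0 c ac k.
exact: (@Ck_on_comp1 _ _ k _ _ _ (f \o cinv c) (@chart_image_open _ _ _ c) (fun z _ => f0 _) (Ck1_powR k a) (sf c ac k)).
Qed.

Lemma smooth_coord c i : atlas c -> smooth_on (cdom c) (fun y => cmap c y 0 i).
Proof. by move=> ac d ad; exact: atlas_compat. Qed.

(** Read in a second chart [d], the function is a partial derivative composed with the transition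
    map from [d] to [c]. *)
Lemma smooth_partial c i f : atlas c -> smooth f ->
  smooth_on (cdom c) (fun y => partial i (f \o cinv c) (cmap c y)).
Proof.
move=> ac sf d ad k.
apply: (@Ck_on_comp _ _ _ k (cmap d @` (cdom d `&` cdom c)) (cmap c @` (cdom c `&` setT))
  (fun z => cmap c (cinv d z)) (partial i (f \o cinv c))).
- by apply: chart_image_openI; exact: cdom_open.
- exact: chart_image_open.
- by move=> _ [x [dx cx] <-]; exists x => //; rewrite cmapK.
- by move=> j; exact: atlas_compat.
- by have [_ /(_ i)[]] := sf c ac k.+1.
Qed.

Lemma smooth_extend U O rho f : open U -> open O -> O `|` U = setT -> smooth rho ->
  (forall x, O x -> rho x = 0) -> smooth_on U f -> smooth (rho \* f).
Proof.
move=> oU oO OU sr r0 sf; apply: smooth_on_local => x _.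
have : (O `|` U) x by rewrite OU.
case=> [Ox|Ux]; [exists O => //|exists U => //].
  apply: (@smooth_on_congr O (fun=> 0)) => //; last exact: smooth_on_cst.
  by move=> y Oy /=; rewrite r0// mul0r.
by apply: smooth_on_mul => //; exact: smooth_on_subset sr.
Qed.

(* The open set [O] records that the support of the bump function is contained
   in [U]; it is what makes extensions by zero smooth. *)
Lemma bump_function (x : M) U : open U -> U x -> exists (rho : M -> R) V O,
  [/\ smooth rho, open V, V x & V `<=` U] /\
  [/\ open O, O `|` U = setT, forall y, V y -> rho y = 1 & forall y, O y -> rho y = 0].
Proof.
move=> oU Ux; have [c ac cx] := atlas_cover x.
pose p := cmap c x.
have [r r0 Hr] : exists2 r : R, 0 < r & forall z : 'rV[R]_n, (forall i, `|z 0 i - p 0 i| <= r) ->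
    (cmap c @` (cdom c `&` U)) z.
  have /open_nbhs_nbhs/nbhs_ballP[r /= r0 Hr] : open_nbhs p (cmap c @` (cdom c `&` U)).
    by split; [exact: chart_image_openI|exists x].
  exists (r / 2); first by rewrite divr_gt0.
  move=> z zr; apply: Hr; split=> // i0 j; rewrite ord1 -ball_normE /ball_ /= distrC.
  by apply: le_lt_trans (zr j) _; rewrite ltr_pdivrMr// ltr_pMr// ltr1n.
pose q (z : 'rV[R]_n) := \sum_i (z 0 i - p 0 i) ^+ 2.
have qi (z : 'rV[R]_n) i : (z 0 i - p 0 i) ^+ 2 <= q z.
  by rewrite /q (bigD1 i)//= lerDl sumr_ge0// => j _; exact: sqr_ge0.
pose K := [set z | q z <= r ^+ 2].
have Kr (z : 'rV[R]_n) i : K z -> `|z 0 i - p 0 i| <= r.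
  move=> Kz; rewrite -(ler_pXn2r (_ : 0 < 2)%N) ?nnegrE//; last exact: ltW.
  by rewrite -normrX ger0_norm ?sqr_ge0//; exact: le_trans (qi z i) Kz.
have KW z : K z -> (cmap c @` (cdom c `&` U)) z by move=> Kz; apply: Hr => i; exact: Kr.
have qc : continuous q.
  move=> z; rewrite (_ : q = \sum_i (fun z : 'rV[R]_n => (z 0 i - p 0 i) ^+ 2)); last first.
    by apply/funext => y; rewrite fct_sumE.
  elim/big_ind: _ => [|F G cF cG|i _]; first exact: cst_continuous.
    by apply: continuousD.
  have ci : {for z, continuous (fun z : 'rV[R]_n => z 0 i - p 0 i)}.
    by apply: continuousB; [exact: coord_continuous|exact: cst_continuous].
  exact: (@continuousM R _ (fun z : 'rV[R]_n => z 0 i - p 0 i) (fun z : 'rV[R]_n => z 0 i - p 0 i) z ci ci).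
have cK : compact K.
  apply: bounded_closed_compact.
    exists (`|p| + r); split=> [|b pb z Kz]; first exact: num_real.
    apply: le_trans (ltW pb); rewrite -[z](subrK p) addrC.
    apply: le_trans (ler_normD _ _) _; rewrite lerD2l.
    rewrite [leLHS]/Num.Def.normr/= mx_normrE; apply: bigmax_le => [|[i j] _] /=; first exact: ltW.
    by rewrite ord1 !mxE; exact: Kr.
  apply: (@preimage_closed _ _ q [set t | t <= r ^+ 2]).
    by move=> ? _; exact: qc.
  exact: closed_le.
(* The Hausdorff property is used here: the compact ball is closed in all of [M], not merely in the
   chart domain, so its complement can serve as the open set where [rho] vanishes. *)
have clK : closed (cinv c @` K).
  apply: compact_closed; first exact: man_hausdorff.
  apply: continuous_compact => //; apply/continuous_in_subspaceT => z; rewrite inE => Kz.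
  by have [y [cy _] <-] := KW z Kz; apply: cinv_cont; exact: cmap_img.
have KdU z : K z -> cdom c (cinv c z) /\ U (cinv c z).
  by move=> Kz; have [y [cy Uy] <-] := KW z Kz; rewrite cmapK.
(* Affine in q and chosen so that s >= 1 for q <= r^2 / 2 and s <= 0 for q >= r^2, the two ranges
   where [smooth_step] is constant. *)
pose s (y : M) : R := 2 - 2 / r ^+ 2 * q (cmap c y).
have r20 : 0 < r ^+ 2 by rewrite exprn_gt0.
have ss : smooth_on (cdom c) s.
  have oc := @cdom_open _ _ _ c.
  have sq : smooth_on (cdom c) (fun y => q (cmap c y)).
    apply: smooth_on_sum => // i.
    have := smooth_on_lin 1 oc (smooth_coord i ac) (smooth_on_cst (- p 0 i) oc).
    move=> s1; apply: (smooth_on_congr oc _ (smooth_on_mul oc s1 s1)) => y _ /=.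
    by rewrite /GRing.scale /= mul1r expr2.
  apply: (smooth_on_congr oc _ (smooth_on_lin (- (2 / r ^+ 2)) oc sq (smooth_on_cst 2 oc))) => y _ /=.
  by rewrite /s /GRing.scale /= mulNr addrC.
pose rho y : R := if y \in cdom c then smooth_step (s y) else 0.
have rho0 y : (~` (cinv c @` K)) y -> rho y = 0.
  move=> nK; rewrite /rho; case: ifP => //; rewrite inE => cy.
  apply: smooth_step_le0; rewrite /s subr_le0 -[leLHS]mulr1 -mulrA ler_pM2l//.
  rewrite mulrC ler_pdivlMr// mul1r leNgt; apply/negP => /ltW Kq; apply: nK.
  by exists (cmap c y) => //; exact: cmapK.
have srho : smooth_on (cdom c) rho.
  apply: (@smooth_on_congr _ (smooth_step \o s)); first exact: cdom_open.
    by move=> y cy; rewrite /rho mem_set.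
  by apply: smooth_on_smooth_step => //; exact: cdom_open.
exists rho, (cdom c `&` [set y | q (cmap c y) < r ^+ 2 / 2]), (~` (cinv c @` K)).
split; split.
- apply: smooth_on_local => y _; have [cy|ncy] := pselect (cdom c y).
    by exists (cdom c).
  exists (~` (cinv c @` K)); first by move=> [z /KdU[cz _] zy]; rewrite zy in cz.
  apply: (@smooth_on_congr _ (fun=> 0)); first by rewrite openC.
    by move=> z /rho0.
  by apply: smooth_on_cst; rewrite openC.
- rewrite openE => y [cy qy]; rewrite /interior; apply: filterI.
    by apply: open_nbhs_nbhs; split=> //; exact: cdom_open.
  have : {for y, continuous (q \o cmap c)}.
    by apply: continuous_comp; [exact: cmap_cont|exact: qc].
  by move=> /(_ [set t | t < r ^+ 2 / 2]); apply; apply: open_nbhs_nbhs; split=> //; exact: open_lt.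
- split=> //=; rewrite -/p /q big1 ?divr_gt0// => i _; by rewrite subrr expr0n.
- move=> y [cy /= qy]; have Kz : K (cmap c y).
    by rewrite /K /= (le_trans (ltW qy))// ler_pdivrMr// ler_peMr// ?ler1n// ltW.
  by have [_] := KdU _ Kz; rewrite cmapK.
- by rewrite openC.
- apply/seteqP; split=> // y _; have [[z Kz <-]|nK] := pselect ((cinv c @` K) y).
    by right; have [] := KdU z Kz.
  by left.
- move=> y [cy /= qy]; rewrite /rho mem_set//; apply: smooth_step_ge1.
  rewrite /s lerBrDr -lerBrDl [leRHS](_ : _ = 1); last by ring.
  by rewrite mulrAC ler_pdivrMr// mul1r mulrC -ler_pdivlMr// ltW.
- exact: rho0.
Qed.

End Manifold.

(** * Tangent vectors and fields *)

Section Tangent.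
Context {R : realType} {n : nat} {M : smooth_manifold R n}.
Implicit Types (U V : set M) (f g : M -> R) (x : M).

Lemma smoothD f g : smooth f -> smooth g -> smooth (fun x => f x + g x).
Proof.
move=> sf sg; have := smooth_lin 1 sf sg.
by congr smooth; apply/funext => x /=; rewrite scale1r.
Qed.

Lemma smoothN f : smooth f -> smooth (fun x => - f x).
Proof.
move=> sf; have := smooth_lin (-1) sf (smooth_cst 0).
by congr smooth; apply/funext => x /=; rewrite scaleN1r addr0.
Qed.

Lemma smoothB f g : smooth f -> smooth g -> smooth (fun x => f x - g x).
Proof. by move=> sf sg; exact: smoothD sf (smoothN sg). Qed.

Lemma smoothM f g : smooth f -> smooth g -> smooth (fun x => f x * g x).
Proof. exact: smooth_mul. Qed.

Lemma tangentP x (v : tangent x) : derivation_at x v.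
Proof. by apply/asboolP; exact: tvalP. Qed.

Lemma tangent_inj x (v w : tangent x) : (forall f, smooth f -> v f = w f) -> v = w.
Proof.
move=> vw; apply: val_inj; apply/funext => f /=; have [/vw//|nf] := pselect (smooth f).
by have [_ _ v0] := tangentP v; have [_ _ w0] := tangentP w; rewrite v0// w0.
Qed.

Lemma tangentDE x (v w : tangent x) f : (v + w) f = v f + w f. Proof. by []. Qed.
Lemma tangentNE x (v : tangent x) f : (- v) f = - v f. Proof. by []. Qed.
Lemma tangentZE x a (v : tangent x) f : (a *: v) f = a * v f. Proof. by []. Qed.

Lemma tangent_sumE x (I : Type) (r : seq I) (v : I -> tangent x) f :
  (\sum_(i <- r) v i) f = \sum_(i <- r) v i f.
Proof. by elim: r => [|i r IH]; rewrite ?big_nil// !big_cons tangentDE IH. Qed.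

Lemma tangentD x (v : tangent x) f g : smooth f -> smooth g ->
  v (fun y => f y + g y) = v f + v g.
Proof.
move=> sf sg; have [l _ _] := tangentP v; rewrite -[v f]mul1r -l//.
by congr (Defs.tval v _); apply/funext => y /=; rewrite scale1r.
Qed.

Lemma tangentM x (v : tangent x) f g : smooth f -> smooth g ->
  v (fun y => f y * g y) = f x * v g + g x * v f.
Proof. by move=> sf sg; have [_ m _] := tangentP v; exact: m. Qed.

Lemma tangent_cst x (v : tangent x) a : v (fun=> a) = 0.
Proof.
have [l m _] := tangentP v; have s1 := @smooth_cst _ _ M 1.
have v1 : v (fun=> 1) = 0.
  have := m _ _ s1 s1; rewrite (_ : (_ \* _) = (fun=> 1)); last first.
    by apply/funext => y /=; rewrite mulr1.
  by rewrite mul1r => /eqP; rewrite -[X in X == _]addr0 (inj_eq (addrI _)) eq_sym => /eqP.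
have v0 : v (fun=> 0) = 0.
  have := l (-1) _ _ s1 s1; rewrite v1 mulr0 addr0.
  rewrite (_ : _ \+ _ = (fun=> 0))//; by apply/funext => y /=; rewrite scaleN1r addNr.
have := l a _ _ s1 (smooth_cst 0); rewrite v1 v0 mulr0 addr0 => <-.
by congr (Defs.tval v _); apply/funext => y /=; rewrite addr0 /GRing.scale /= mulr1.
Qed.

Lemma smooth_fieldD (V W : field M) : smooth_field V -> smooth_field W ->
  smooth_field (fun x => V x + W x).
Proof. by move=> sV sW f sf; apply: smoothD; [exact: sV|exact: sW]. Qed.

Lemma smooth_fieldZ h (V : field M) : smooth h -> smooth_field V ->
  smooth_field (fun x => h x *: V x).
Proof. by move=> sh sV f sf; apply: smoothM => //; exact: sV. Qed.

Lemma smooth_fieldN (V : field M) : smooth_field V -> smooth_field (fun x => - V x).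
Proof. by move=> sV f sf; apply: smoothN; exact: sV. Qed.

Lemma smooth_fieldB (V W : field M) : smooth_field V -> smooth_field W ->
  smooth_field (fun x => V x - W x).
Proof. by move=> sV sW; apply: smooth_fieldD => //; exact: smooth_fieldN. Qed.

Lemma smooth_field_sum (I : Type) (r : seq I) (V : I -> field M) :
  (forall i, smooth_field (V i)) -> smooth_field (fun x => \sum_(i <- r) V i x).
Proof.
move=> sV f sf; have := @smooth_sum _ _ _ _ r (fun i => apply_field (V i) f) (fun i => sV i f sf).
by congr smooth; apply/funext => x; rewrite /apply_field tangent_sumE.
Qed.

Lemma smooth_field_local (V : field M) :
  (forall x, exists2 U, open U & U x /\ exists2 W, smooth_field W & forall y, U y -> V y = W y) ->
  smooth_field V.
Proof.
move=> lV f sf; apply: smooth_local => x; have [U oU [Ux [W sW VW]]] := lV x.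
exists U => //; split=> //; exists (apply_field W f); first exact: sW.
by move=> y Uy; rewrite /apply_field VW.
Qed.

Lemma smooth_continuous f x : smooth f -> {for x, continuous f}.
Proof.
move=> sf; have [c ac cx] := atlas_cover x.
have ci : {for x, continuous ((f \o cinv c) \o cmap c)}.
  apply: continuous_comp; first exact: cmap_cont.
  by have [+ _] := sf c ac 0%N; apply; exists x.
move: ci; rewrite /prop_for /continuous_at /= cmapK//; apply: cvg_trans; apply: near_eq_cvg.
have : nbhs x (cdom c) by apply: open_nbhs_nbhs; split=> //; exact: cdom_open.
by apply: filterS => y cy /=; rewrite cmapK.
Qed.

(** Real powers are smooth only on positive functions. This lets reciprocals and inverse square
    roots of [f], needed only near [x], be taken on all of [M]. *)
Lemma positive_extension f x : smooth f -> 0 < f x -> exists g V,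
  [/\ smooth g, forall y, 0 < g y, open V, V x & forall y, V y -> g y = f y].
Proof.
move=> sf f0; have oU : open [set y | 0 < f y].
  rewrite openE => y fy; rewrite /interior.
  have /(_ [set t | 0 < t]) := @smooth_continuous f y sf; apply.
  by apply: open_nbhs_nbhs; split=> //; exact: open_gt.
have [rho [V [Q [] [sr oV Vx VU] [oO OU r1 r0]]]] := bump_function oU f0.
pose r' y := 1 - rho y.
have sr' : smooth r' by apply: smoothB => //; exact: smooth_cst.
(* Squares, because no bound on the values of [rho] is at hand. Where f <= 0 the bump vanishes and
   the second square is 1. *)
exists (fun y => rho y * rho y * f y + r' y * r' y), V; split=> //.
- by apply: smoothD; apply: smoothM => //; apply: smoothM.
- move=> y; have : (Q `|` [set y | 0 < f y]) y by rewrite OU.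
  rewrite /r' => -[/r0->|/= fy]; first by rewrite subr0 !mul0r add0r mulr1.
  have [->|n0] := eqVneq (rho y) 0; first by rewrite subr0 !mul0r add0r mulr1.
  apply: ltr_wpDr; first by rewrite -expr2 sqr_ge0.
  by rewrite mulr_gt0// -expr2 lt_neqAle sqr_ge0 eq_sym expf_neq0.
- by move=> y Vy; rewrite /r' r1// subrr mul0r addr0 !mul1r.
Qed.

Lemma coordinate_fields x : exists (D : 'I_n -> field M) (u : 'I_n -> M -> R),
  [/\ forall i, smooth_field (D i), forall i, smooth (u i)
    & forall i j, D i x (u j) = (i == j)%:R].
Proof.
have [c ac cx] := atlas_cover x.
have [rho [V [Q [] [sr oV Vx VU] [oO OU r1 r0]]]] := bump_function (@cdom_open _ _ _ c) cx.
have dsm f i y : smooth f -> cdom c y -> derivable (f \o cinv c) (cmap c y) (delta_mx 0 i).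
  move=> sf cy; have [_ /(_ i)[+ _]] := sf c ac 1%N.
  by apply; exists y.
(* The guard on [smooth f] enforces the convention that derivations vanish on nonsmooth functions;
   off the chart domain [rho] is 0 anyway. *)
pose d i y f := if `[< smooth f /\ cdom c y >] then rho y * partial i (f \o cinv c) (cmap c y) else 0.
have dD i y : derivation_at y (d i y).
  have [cy|ncy] := pselect (cdom c y); last first.
    have d0 f : d i y f = 0 by rewrite /d; case: asboolP => // -[].
    by split=> *; rewrite !d0 ?mulr0 ?addr0.
  have dE f : smooth f -> d i y f = rho y * partial i (f \o cinv c) (cmap c y).
    by move=> sf; rewrite /d asboolT.
  split=> [a f g sf sg|f g sf sg|f nsf].
  - rewrite !dE//; last exact: smooth_lin.
    rewrite /partial (_ : _ \o _ = a \*: (f \o cinv c) + (g \o cinv c))//.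
    rewrite deriveD; [|exact/derivableZ/dsm|exact: dsm].
    rewrite deriveZ; last exact: dsm.
    by rewrite /GRing.scale /=; ring.
  - rewrite !dE//; last exact: smooth_mul.
    rewrite /partial (_ : _ \o _ = (f \o cinv c) * (g \o cinv c))//.
    rewrite deriveM; [|exact: dsm|exact: dsm].
    by rewrite /= cmapK// /GRing.scale /=; ring.
  - by rewrite /d asboolF// => -[].
pose D i : field M := fun y => Tangent (asboolT (dD i y) : d i y \in derivations y).
pose u j : M -> R := rho \* (fun y => cmap c y 0 j).
have su j : smooth (u j).
  apply: (smooth_extend (@cdom_open _ _ _ c) oO OU sr r0); exact: smooth_coord.
exists D, u; split=> // [i f sf|i j].
  have := smooth_extend (@cdom_open _ _ _ c) oO OU sr r0 (smooth_partial i ac sf).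
  congr smooth; apply/funext => y; rewrite /apply_field /= /d.
  case: asboolP => // nsc; rewrite r0 ?mul0r//.
  have : (Q `|` cdom c) y by rewrite OU.
  by case=> // cy; case: nsc.
rewrite /= /d asboolT// r1// mul1r /partial.
have -> : 'D_('e_i) (u j \o cinv c) (cmap c x) = 'D_('e_i) (fun z : 'rV[R]_n => z 0 j) (cmap c x).
  apply: near_eq_derive.
  have N1 : \forall z \near cmap c x, cimg c z.
    by apply: open_nbhs_nbhs; split; [exact: cimg_open|exact: cmap_img].
  have N2 : \forall z \near cmap c x, V (cinv c z).
    by apply: (cinv_cont (cmap_img cx)); rewrite /= cmapK//; exact: open_nbhs_nbhs.
  by apply: filterS2 N1 N2 => z cz Vz; rewrite /= /u /= r1// mul1r cinvK.
apply: lim_near_cst => //; near=> h.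
have h0 : h != 0 by near: h; exact: nbhs_dnbhs_neq.
by rewrite /= !mxE addrK eqxx /= /GRing.scale /= mulrA mulVf// mul1r eq_sym.
Unshelve. all: by end_near. Qed.

End Tangent.

(** * Sections and curvature *)

Section Sections.
Context {R : realType} {n : nat} {M : smooth_manifold R n} {k : nat}.
Variable E : vector_bundle M k.
Implicit Types (U : set M) (f : M -> R) (x : M) (s t : section E).

Lemma smooth_section0 : smooth_section (fun x => 0 : E x).
Proof.
move=> F fF; exists (fun _ _ => 0); split=> [i|x Fx].
  exact: smooth_on_cst (frame_open fF).
by rewrite big1// => i _; rewrite scale0r.
Qed.

Lemma smooth_sectionD s t : smooth_section s -> smooth_section t ->
  smooth_section (fun x => s x + t x).
Proof.
move=> ss st F fF; have [a [sa Ea]] := ss F fF; have [b [sb Eb]] := st F fF.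
exists (fun i => 1 \*: a i \+ b i); split=> [i|x Fx].
  exact: smooth_on_lin (frame_open fF) (sa i) (sb i).
by rewrite Ea// Eb// -big_split; apply: eq_bigr => i _ /=; rewrite scale1r scalerDl.
Qed.

Lemma smooth_sectionZ f s : smooth f -> smooth_section s ->
  smooth_section (fun x => f x *: s x).
Proof.
move=> sf ss F fF; have [a [sa Ea]] := ss F fF.
exists (fun i => f \* a i); split=> [i|x Fx].
  apply: smooth_on_mul (frame_open fF) _ (sa i); exact: smooth_on_subset sf.
by rewrite Ea// scaler_sumr; apply: eq_bigr => i _; rewrite scalerA.
Qed.

Lemma smooth_sectionN s : smooth_section s -> smooth_section (fun x => - s x).
Proof.
move=> ss; have := smooth_sectionZ (smooth_cst (-1)) ss.
by congr smooth_section; apply/functional_extensionality_dep => x; rewrite scaleN1r.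
Qed.

Lemma smooth_section_sum (I : Type) (r : seq I) (S : I -> section E) :
  (forall i, smooth_section (S i)) -> smooth_section (fun x => \sum_(i <- r) S i x).
Proof.
move=> sS; elim: r => [|i r IH].
  have := smooth_section0; congr smooth_section.
  by apply/functional_extensionality_dep => x; rewrite big_nil.
have := smooth_sectionD (sS i) IH; congr smooth_section.
by apply/functional_extensionality_dep => x; rewrite big_cons.
Qed.

Lemma frame_coef (F : local_frame E k) x (a b : 'I_k -> R) : frames F -> fdom F x ->
  \sum_i a i *: fvec F i x = \sum_i b i *: fvec F i x -> forall i, a i = b i.
Proof.
move=> fF Fx ab i; have [c [_ cu]] := frame_basis fF Fx (\sum_i a i *: fvec F i x).
have ca : c = \row_i a i.
  by apply: cu; apply: eq_bigr => j _; rewrite mxE.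
have cb : c = \row_i b i.
  by apply: cu; rewrite ab; apply: eq_bigr => j _; rewrite mxE.
have /rowP/(_ i) : \row_i a i = \row_i b i by rewrite -ca -cb.
by rewrite !mxE.
Qed.

(** The coefficients of [s] in a frame are picked pointwise by choice; their uniqueness identifies
    them near each point with the smooth coefficients of [t]. *)
Lemma smooth_section_local s :
  (forall x, exists2 U, open U & U x /\ exists2 t, smooth_section t & forall y, U y -> s y = t y) ->
  smooth_section s.
Proof.
move=> ls F fF.
have /choice[a Ea] : forall x, exists a : 'rV[R]_k, fdom F x -> s x = \sum_i a 0 i *: fvec F i x.
  move=> x; have [Fx|nFx] := pselect (fdom F x); last by exists 0 => /nFx.
  by have [b [Eb _]] := frame_basis fF Fx (s x); exists b.
exists (fun i x => a x 0 i); split=> // i; apply: smooth_on_local => x Fx.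
have [U oU [Ux [t st stE]]] := ls x; have [b [sb Eb]] := st F fF.
exists (U `&` fdom F) => //; apply: (@smooth_on_congr _ _ _ _ (b i)).
- by apply: openI => //; exact: frame_open.
- move=> y [Uy Fy]; apply: (frame_coef fF Fy (a := b ^~ y) (b := fun i => a y 0 i)).
  by rewrite -Eb// -Ea// stE.
- by apply: smooth_on_subset (sb i) => y [].
Qed.

Lemma smooth_section_frame (F : local_frame E k) j U rho : frames F -> open U -> U `|` fdom F = setT ->
  smooth rho -> (forall x, U x -> rho x = 0) ->
  smooth_section (fun x => rho x *: fvec F j x).
Proof.
move=> fF oU UF sr r0 G fG; have [a [sa Ea]] := frame_transition fF fG.
exists (fun i => rho \* (fun x => if `[< fdom F x >] then a j i x else 0)); split.
  move=> i; have oG := frame_open fG; have oF := frame_open fF.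
  apply: smooth_on_local => x Gx; have : (U `|` fdom F) x by rewrite UF.
  case=> [Ux|Fx]; [exists (U `&` fdom G) => //|exists (fdom F `&` fdom G) => //].
    apply: (@smooth_on_congr _ _ _ _ (fun=> 0)); [exact: openI| |].
      by move=> y [Uy _] /=; rewrite r0// mul0r.
    by apply: smooth_on_cst; exact: openI.
  apply: smooth_on_mul; [exact: openI|exact: smooth_on_subset sr|].
  apply: (@smooth_on_congr _ _ _ _ (a j i)); [exact: openI| |exact: sa].
  by move=> y [Fy _]; rewrite asboolT.
move=> x Gx; have : (U `|` fdom F) x by rewrite UF.
case=> [Ux|Fx].
  by rewrite r0// scale0r big1// => i _; rewrite /= r0// mul0r scale0r.
rewrite Ea// scaler_sumr; apply: eq_bigr => i _.
by rewrite scalerA /= asboolT.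
Qed.

Variable D : connection E.

Lemma covDl x (v w : tangent x) s : smooth_section s -> cov D (v + w) s = cov D v s + cov D w s.
Proof. by move=> ss; have := cov_linear D ss 1 v w; rewrite !scale1r. Qed.

Lemma cov0l x s : smooth_section s -> cov D (0 : tangent x) s = 0.
Proof.
move=> ss; have := covDl (0 : tangent x) 0 ss.
by rewrite addr0 => /eqP; rewrite -[X in X == _]addr0 (inj_eq (addrI _)) eq_sym => /eqP.
Qed.

Lemma covZl x a (v : tangent x) s : smooth_section s -> cov D (a *: v) s = a *: cov D v s.
Proof. by move=> ss; have := cov_linear D ss a v 0; rewrite !addr0 cov0l// addr0. Qed.

Lemma covNl x (v : tangent x) s : smooth_section s -> cov D (- v) s = - cov D v s.
Proof. by move=> ss; have := covZl (-1) v ss; rewrite !scaleN1r. Qed.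

Lemma covBl x (v w : tangent x) s : smooth_section s -> cov D (v - w) s = cov D v s - cov D w s.
Proof. by move=> ss; rewrite covDl// covNl. Qed.

Lemma cov_suml x (I : Type) (r : seq I) (v : I -> tangent x) s : smooth_section s ->
  cov D (\sum_(i <- r) v i) s = \sum_(i <- r) cov D (v i) s.
Proof.
by move=> ss; elim: r => [|i r IH]; rewrite ?big_nil ?cov0l// !big_cons covDl// IH.
Qed.

Implicit Types (V W : field M).

Lemma bracketC V W x : smooth_field V -> smooth_field W -> bracket V W x = - bracket W V x.
Proof.
by move=> sV sW; apply: tangent_inj => f sf; rewrite tangentNE !bracketE// opprB.
Qed.

Lemma bracketDl V1 V2 W x : smooth_field V1 -> smooth_field V2 -> smooth_field W ->
  bracket (fun y => V1 y + V2 y) W x = bracket V1 W x + bracket V2 W x.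
Proof.
move=> sV1 sV2 sW; apply: tangent_inj => f sf; rewrite tangentDE !bracketE//.
  rewrite tangentDE (_ : apply_field (fun y => V1 y + V2 y) f = fun y => apply_field V1 f y + apply_field V2 f y)//.
  rewrite tangentD; [|exact: sV1|exact: sV2].
  by rewrite opprD addrACA.
exact: smooth_fieldD.
Qed.

Lemma bracketZl h V W x : smooth h -> smooth_field V -> smooth_field W ->
  bracket (fun y => h y *: V y) W x = h x *: bracket V W x - W x h *: V x.
Proof.
move=> sh sV sW; apply: tangent_inj => f sf.
rewrite tangentDE tangentNE !tangentZE !bracketE//; last exact: smooth_fieldZ.
rewrite tangentZE (_ : apply_field (fun y => h y *: V y) f = fun y => h y * apply_field V f y)//.
rewrite tangentM//; last exact: sV.
by rewrite /apply_field; ring.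
Qed.

Lemma curvatureC V W s x : smooth_field V -> smooth_field W -> smooth_section s ->
  curvature D V W s x = - curvature D W V s x.
Proof.
move=> sV sW ss; rewrite /curvature bracketC// covNl//.
by rewrite !opprD !opprK; congr (_ + _); rewrite addrC.
Qed.

Lemma curvatureDl V1 V2 W s x : smooth_field V1 -> smooth_field V2 -> smooth_field W ->
  smooth_section s ->
  curvature D (fun y => V1 y + V2 y) W s x = curvature D V1 W s x + curvature D V2 W s x.
Proof.
move=> sV1 sV2 sW ss; rewrite /curvature bracketDl// !covDl//; last exact: cov_smooth.
rewrite (_ : (fun y => cov D (V1 y + V2 y) s) = fun y => cov D (V1 y) s + cov D (V2 y) s); last first.
  by apply/functional_extensionality_dep => y; rewrite covDl.
rewrite cov_add; [|exact: cov_smooth|exact: cov_smooth].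
by rewrite !opprD [RHS]addrACA [X in _ = X + _]addrACA.
Qed.

(** The derivative of [h] along [W] arises from the Leibniz rule and from the bracket [h V, W], and
    the two contributions cancel. *)
Lemma curvatureZl h V W s x : smooth h -> smooth_field V -> smooth_field W ->
  smooth_section s -> curvature D (fun y => h y *: V y) W s x = h x *: curvature D V W s x.
Proof.
move=> sh sV sW ss; rewrite /curvature bracketZl// covBl// !covZl//; last exact: cov_smooth.
rewrite (_ : (fun y => cov D (h y *: V y) s) = fun y => h y *: cov D (V y) s); last first.
  by apply/functional_extensionality_dep => y; rewrite covZl.
rewrite cov_leibniz//; last exact: cov_smooth.
rewrite !scalerBr !opprD !opprK !addrA [LHS]addrAC; congr (_ - _).
by rewrite addrAC subrK.
Qed.

Lemma curvatureDs V W s t x : smooth_field V -> smooth_field W ->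
  smooth_section s -> smooth_section t ->
  curvature D V W (fun y => s y + t y) x = curvature D V W s x + curvature D V W t x.
Proof.
move=> sV sW ss st; rewrite /curvature.
have H (X : field M) : (fun y => cov D (X y) (fun z => s z + t z)) = fun y => cov D (X y) s + cov D (X y) t.
  by apply/functional_extensionality_dep => y; rewrite cov_add.
rewrite !H !cov_add//; try exact: cov_smooth.
by rewrite !opprD [RHS]addrACA [X in _ = X + _]addrACA.
Qed.

(** The first derivatives of [h] enter symmetrically in [V] and [W] (the terms [q1], [q2] of [Z]),
    and the second derivatives ([p1], [p2]) cancel against [V, W] h. *)
Lemma curvatureZs h V W s x : smooth h -> smooth_field V -> smooth_field W ->
  smooth_section s -> curvature D V W (fun y => h y *: s y) x = h x *: curvature D V W s x.
Proof.
move=> sh sV sW ss; rewrite /curvature.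
have H (X : field M) : (fun y => cov D (X y) (fun z => h z *: s z)) =
    fun y => apply_field X h y *: s y + h y *: cov D (X y) s.
  by apply/functional_extensionality_dep => y; rewrite cov_leibniz.
have sVs := cov_smooth D sV ss; have sWs := cov_smooth D sW ss.
have sVh := sV _ sh; have sWh := sW _ sh.
rewrite !H !cov_add; try by apply: smooth_sectionZ.
rewrite !cov_leibniz// bracketE// scalerBl !scalerBr.
have Z (p1 p2 q1 q2 r1 r2 r3 : E x) :
    (p1 + q1 + (q2 + r1)) - (p2 + q2 + (q1 + r2)) - (p1 - p2 + r3) = r1 - r2 - r3.
  have q (p a b r : E x) : p + a + (b + r) = p + (a + b) + r by rewrite !addrA.
  rewrite !q (addrC q2) (opprD (_ + _)) addrACA (opprD p2) (addrACA p1) subrr addr0.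
  by rewrite (opprD (p1 - p2)) [LHS]addrACA subrr add0r.
exact: Z.
Qed.

(** With a bump [rho] supported in [U], the fields rho V and rho V' agree globally, and [rho] is 1
    at [x]. *)
Lemma curvature_local V V' W s x U : open U -> U x -> smooth_field V -> smooth_field V' ->
  smooth_field W -> smooth_section s -> (forall y, U y -> V y = V' y) ->
  curvature D V W s x = curvature D V' W s x.
Proof.
move=> oU Ux sV sV' sW ss E1; have [rho [V0 [Q [] [sr oV Vx VU] [oO OU r1 r0]]]] := bump_function oU Ux.
have E2 : (fun y => rho y *: V y) = (fun y => rho y *: V' y).
  apply/functional_extensionality_dep => y; have : (Q `|` U) y by rewrite OU.
  by case=> [/r0->|/E1->//]; rewrite !scale0r.
have := curvatureZl x sr sV sW ss; rewrite E2 curvatureZl// r1// !scale1r.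
by [].
Qed.

Lemma curvature_suml (I : Type) (r : seq I) (V : I -> field M) W s x :
  (forall i, smooth_field (V i)) -> smooth_field W -> smooth_section s ->
  curvature D (fun y => \sum_(i <- r) V i y) W s x = \sum_(i <- r) curvature D (V i) W s x.
Proof.
move=> sV sW ss; elim: r => [|i r IH].
  rewrite big_nil -[RHS](scale0r (curvature D W W s x)) -(curvatureZl x (smooth_cst 0))//.
  congr (curvature D _ W s x).
  by apply/functional_extensionality_dep => y; rewrite big_nil scale0r.
rewrite big_cons -IH -curvatureDl//; last exact: smooth_field_sum.
congr (curvature D _ W s x).
by apply/functional_extensionality_dep => y; rewrite big_cons.
Qed.

Lemma curvature_sums (I : Type) (r : seq I) V W (S : I -> section E) x :
  smooth_field V -> smooth_field W -> (forall i, smooth_section (S i)) ->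
  curvature D V W (fun y => \sum_(i <- r) S i y) x = \sum_(i <- r) curvature D V W (S i) x.
Proof.
move=> sV sW ss; elim: r => [|i r IH].
  rewrite big_nil -[RHS](scale0r (curvature D V W (fun=> 0) x)).
  rewrite -(curvatureZs x (smooth_cst 0))//; last exact: smooth_section0.
  congr (curvature D V W _ x).
  by apply/functional_extensionality_dep => y; rewrite big_nil scale0r.
rewrite big_cons -IH -curvatureDs//; last exact: smooth_section_sum.
congr (curvature D V W _ x).
by apply/functional_extensionality_dep => y; rewrite big_cons.
Qed.

(** Tensoriality in the form used later: the coefficients come out of the curvature and are
    evaluated at [x]. *)
Lemma curvature_vanish (I : finType) (B : I -> field M) (c : I -> M -> R) V W s x U :
  open U -> U x -> smooth_field V -> smooth_field W -> smooth_section s ->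
  (forall i, smooth_field (B i)) -> (forall i, smooth (c i)) ->
  (forall y, U y -> V y = \sum_i c i y *: B i y) -> (forall i, c i x = 0) ->
  curvature D V W s x = 0.
Proof.
move=> oU Ux sV sW ss sB sc VE c0.
have sV' : smooth_field (fun y => \sum_i c i y *: B i y).
  by apply: smooth_field_sum => i; exact: smooth_fieldZ.
rewrite (curvature_local oU Ux sV sV' sW ss VE) curvature_suml//.
  by apply: big1 => i _; rewrite curvatureZl// c0 scale0r.
by move=> i; exact: smooth_fieldZ.
Qed.

Lemma curvature_vanish_section (I : finType) (B : I -> section E) (c : I -> M -> R) V W s x U :
  open U -> U x -> smooth_field V -> smooth_field W -> smooth_section s ->
  (forall i, smooth_section (B i)) -> (forall i, smooth (c i)) ->
  (forall y, U y -> s y = \sum_i c i y *: B i y) -> (forall i, c i x = 0) ->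
  curvature D V W s x = 0.
Proof.
move=> oU Ux sV sW ss sB sc sE c0.
have [rho [V0 [Q [] [sr oV Vx VU] [oO OU r1 r0]]]] := bump_function oU Ux.
(* The expansion of [s] holds only on [U]; inserting the factor [rho], equal to 1 at [x], makes it
   global. *)
rewrite -[LHS]scale1r -(r1 x Vx) -curvatureZs//.
rewrite (_ : (fun y => rho y *: s y) = fun y => \sum_i (rho y * c i y) *: B i y).
  rewrite curvature_sums//; last by move=> i; apply: smooth_sectionZ => //; exact: smoothM.
  apply: big1 => i _; rewrite (@curvatureZs (fun y => rho y * c i y))//; last exact: smoothM.
  by rewrite c0 mulr0 scale0r.
apply/functional_extensionality_dep => y; have : (Q `|` U) y by rewrite OU.
case=> [/r0->|/sE->].
  by rewrite scale0r big1// => i _; rewrite mul0r scale0r.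
by rewrite scaler_sumr; apply: eq_bigr => i _; rewrite scalerA.
Qed.

End Sections.

(** * Pointwise Lorentzian algebra *)

Section Forms.
Context {R : realType} {V : lmodType R}.
Variable b : V -> V -> R.
Hypothesis bb : bilinear_form b.

Lemma bformDl u v w : b (u + v) w = b u w + b v w.
Proof. by have [l _] := bb; rewrite -[X in _ = X + _]mul1r -[u in LHS]scale1r; exact: l. Qed.

Lemma bform0l w : b 0 w = 0.
Proof.
have := bformDl 0 0 w; rewrite addr0 => /eqP.
by rewrite -[X in X == _]addr0 (inj_eq (addrI _)) eq_sym => /eqP.
Qed.

Lemma bformZl a u w : b (a *: u) w = a * b u w.
Proof. by have [l _] := bb; rewrite -[a *: u]addr0 l bform0l addr0. Qed.

Lemma bformNl u w : b (- u) w = - b u w.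
Proof. by rewrite -scaleN1r bformZl mulN1r. Qed.

Lemma bformBl u v w : b (u - v) w = b u w - b v w.
Proof. by rewrite bformDl bformNl. Qed.

Lemma bform_suml (I : Type) (r : seq I) (F : I -> V) w :
  b (\sum_(i <- r) F i) w = \sum_(i <- r) b (F i) w.
Proof. by elim: r => [|i r IH]; rewrite ?big_nil ?bform0l// !big_cons bformDl IH. Qed.

Lemma bformDr u v w : b w (u + v) = b w u + b w v.
Proof. by have [_ l] := bb; rewrite -[X in _ = X + _]mul1r -[u in LHS]scale1r; exact: l. Qed.

Lemma bform0r w : b w 0 = 0.
Proof.
have := bformDr 0 0 w; rewrite addr0 => /eqP.
by rewrite -[X in X == _]addr0 (inj_eq (addrI _)) eq_sym => /eqP.
Qed.

Lemma bformZr a u w : b w (a *: u) = a * b w u.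
Proof. by have [_ l] := bb; rewrite -[a *: u]addr0 l bform0r addr0. Qed.

Lemma bformNr u w : b w (- u) = - b w u.
Proof. by rewrite -scaleN1r bformZr mulN1r. Qed.

Lemma bformBr u v w : b w (u - v) = b w u - b w v.
Proof. by rewrite bformDr bformNr. Qed.

Lemma bform_sumr (I : Type) (r : seq I) (F : I -> V) w :
  b w (\sum_(i <- r) F i) = \sum_(i <- r) b w (F i).
Proof. by elim: r => [|i r IH]; rewrite ?big_nil ?bform0r// !big_cons bformDr IH. Qed.

Lemma psd_radical v : Defs.symmetric_form b -> (forall w, 0 <= b w w) -> b v v = 0 ->
  forall w, b v w = 0.
Proof.
move=> sb b0 vv w.
(* The Cauchy-Schwarz argument with a denominator that stays positive when [b w w] is 0: with p = b
   v w, the vector v - (p / d) w has square - p^2 (d + 1) / d^2, which forces p = 0. *)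
pose d := b w w + 1; have d0 : 0 < d by rewrite ltr_wpDl.
have d1 : 0 < d + 1 by apply: addr_gt0.
have := b0 (- (b v w / d) *: w + v).
rewrite !(bformDl, bformDr, bformZl, bformZr) vv (sb w v).
set p := b v w; have -> : b w w = d - 1 by rewrite /d addrK.
have -> : - (p / d) * (- (p / d) * (d - 1)) + - (p / d) * p + (- (p / d) * p + 0)
   = - (p ^+ 2 * (d + 1) / d ^+ 2) by field; exact: lt0r_neq0.
rewrite oppr_ge0 ler_pdivrMr ?exprn_gt0// mul0r pmulr_lle0// => p2.
have : p ^+ 2 == 0 by rewrite eq_le p2 sqr_ge0.
by rewrite sqrf_eq0 => /eqP.
Qed.

Lemma lorentzian_nondegenerate k v : lorentzian k b -> (forall w, b v w = 0) -> v = 0.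
Proof.
move=> [e [eB eE]] v0; have [a [Ev _]] := eB v; rewrite Ev big1// => i _.
have := v0 (e i); rewrite Ev bform_suml (bigD1 i)//= big1 => [|j ji]; last first.
  by rewrite bformZl eE ji mulr0.
rewrite bformZl eE eqxx addr0 /=; case: ifP => _ /eqP.
  by rewrite mulrN1 oppr_eq0 => /eqP->; rewrite scale0r.
by rewrite mulr1 => /eqP->; rewrite scale0r.
Qed.

End Forms.

Lemma is_basis_free (R : realType) (V : lmodType R) k (e f : 'I_k -> V) : is_basis e ->
  (forall c : 'rV[R]_k, \sum_i c 0 i *: f i = 0 -> c = 0) -> is_basis f.
Proof.
move=> eB free.
have /choice[A EA] : forall i, exists a : 'rV[R]_k, f i = \sum_j a 0 j *: e j.
  by move=> i; have [a [Ea _]] := eB (f i); exists a.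
pose P := \matrix_i A i.
have sum_coef (c : 'rV[R]_k) : \sum_i c 0 i *: f i = \sum_j (c *m P) 0 j *: e j.
  under eq_bigr => i _ do rewrite EA scaler_sumr.
  rewrite exchange_big; apply: eq_bigr => j _; rewrite mxE scaler_suml.
  by apply: eq_bigr => i _; rewrite scalerA !mxE.
have uP : P \in unitmx.
  rewrite -row_free_unit -kermx_eq0; apply/eqP/row_matrixP => i; rewrite row0.
  apply: free; rewrite sum_coef -row_mul mulmx_ker row0.
  by rewrite big1// => j _; rewrite mxE scale0r.
move=> v; have [a [Ea ua]] := eB v; exists (a *m invmx P); split=> [|c Ec].
  by rewrite sum_coef mulmxKV.
by rewrite (ua (c *m P)) ?mulmxK// Ec sum_coef.
Qed.

(** * The splitting of a fibre by an orthonormal frame and its null dual *)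

Section LightlikeExtension.
Context {R : realType} {m : nat} {N : lightlike_manifold R m}.
Variable T : lightlike_extension N.
Hypothesis hfor : extension_for T.
Implicit Types (x : N) (t : forall x : N, tangent x -> R).

Local Notation xi := (xi T).
Let hTb x := hT_bilinear T x.
Let hNb x := hN_bilinear x.

Lemma xi_xi x : hT (xi x) (xi x) = 0.
Proof. by have [] := xi_lightlike T x. Qed.

Lemma PhiD x (v w : tangent x) : Phi T (v + w) = Phi T v + Phi T w.
Proof. by rewrite /Phi covDl//; exact: xi_smooth. Qed.

Lemma PhiZ x a (v : tangent x) : Phi T (a *: v) = a *: Phi T v.
Proof. by rewrite /Phi covZl//; exact: xi_smooth. Qed.

Lemma Phi_sum x (I : Type) (r : seq I) (v : I -> tangent x) :
  Phi T (\sum_(i <- r) v i) = \sum_(i <- r) Phi T (v i).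
Proof. by rewrite /Phi cov_suml//; exact: xi_smooth. Qed.

Lemma Phi_inj x : injective (@Phi R m N T x).
Proof. exact: xi_mono. Qed.

Lemma PhiK x : cancel (@Phi R m N T x) (@Phi_inv R m N T x).
Proof.
move=> v; rewrite /Phi_inv; apply: Phi_inj.
by have := @xgetPex _ 0 [set w | Phi T w = Phi T v] (ex_intro _ v erefl).
Qed.

Lemma hT_Phi x (v w : tangent x) : hT (Phi T v) (Phi T w) = hN v w.
Proof. by have [-> _] := hfor. Qed.

Lemma Phi_ZN x : Phi T (ZN N x) = xi x.
Proof. by have [_ ->] := hfor. Qed.

Lemma hN_ZNl x (v : tangent x) : hN (ZN N x) v = 0.
Proof. by have [_] := ZN_span (ZN N x); apply; exists 1; rewrite scale1r. Qed.

Lemma hN_ZNr x (v : tangent x) : hN v (ZN N x) = 0.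
Proof. by rewrite hN_sym hN_ZNl. Qed.

Lemma hT_Phi_xi x (v : tangent x) : hT (Phi T v) (xi x) = 0.
Proof. by rewrite -Phi_ZN hT_Phi hN_ZNr. Qed.

Lemma hT_xi_Phi x (v : tangent x) : hT (xi x) (Phi T v) = 0.
Proof. by rewrite hT_sym hT_Phi_xi. Qed.

Definition orthonormal x k (E : 'I_k -> tangent x) : Prop :=
  forall i j, hN (E i) (E j) = (i == j)%:R.

Lemma orthonormal_coef x (E : 'I_m -> tangent x) (c : 'I_m -> R) i : orthonormal E ->
  hN (\sum_j c j *: E j) (E i) = c i.
Proof.
move=> oE; rewrite (bform_suml (hNb x)) (bigD1 i)//= big1 => [|j ji].
  by rewrite (bformZl (hNb x)) oE eqxx mulr1 addr0.
by rewrite (bformZl (hNb x)) oE (negbTE ji) mulr0.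
Qed.

(** The conditions that determine [eta], tested on a frame; this allows algebra in one fibre before
    any transverse form is given. *)
Definition null_dual x (E : 'I_m -> tangent x) (e : bun T x) : Prop :=
  [/\ hT e e = 0, hT (xi x) e = 1 & forall i, hT (Phi T (E i)) e = 0].

(** Pairing with [e], [xi] and the [Phi T (E i)] recovers every coefficient of a combination of
    these m + 2 vectors, so they are independent, hence a basis by the rank of the bundle. *)
Lemma null_dual_expand x (E : 'I_m -> tangent x) e (s : bun T x) :
  orthonormal E -> null_dual E e ->
  s = hT s e *: xi x + \sum_i hT s (Phi T (E i)) *: Phi T (E i) + hT s (xi x) *: e.
Proof.
move=> oE [ee xie Ee].
pose f (i : 'I_m.+2) := if unlift ord0 i is Some j then
  if unlift ord0 j is Some k then Phi T (E k) else e else xi x.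
have sumf (c : 'rV[R]_m.+2) : \sum_i c 0 i *: f i = c 0 0 *: xi x +
    (c 0 (lift 0 0) *: e + \sum_i c 0 (lift 0 (lift 0 i)) *: Phi T (E i)).
  by rewrite !big_ord_recl /f unlift_none liftK unlift_none; do 2!congr (_ + _);
    apply: eq_bigr => i _; rewrite !liftK.
have pe c0 c1 (c : 'I_m -> R) :
    hT (c0 *: xi x + (c1 *: e + \sum_i c i *: Phi T (E i))) e = c0.
  rewrite !(bformDl (hTb x)) !(bformZl (hTb x)) (bform_suml (hTb x)) ee xie big1 => [|i _].
    by rewrite mulr0 mulr1 !addr0.
  by rewrite (bformZl (hTb x)) Ee mulr0.
have px c0 c1 (c : 'I_m -> R) :
    hT (c0 *: xi x + (c1 *: e + \sum_i c i *: Phi T (E i))) (xi x) = c1.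
  rewrite !(bformDl (hTb x)) !(bformZl (hTb x)) (bform_suml (hTb x)) (hT_sym e) xie xi_xi big1 => [|i _].
    by rewrite mulr0 mulr1 addr0 add0r.
  by rewrite (bformZl (hTb x)) hT_Phi_xi mulr0.
have pE c0 c1 (c : 'I_m -> R) j :
    hT (c0 *: xi x + (c1 *: e + \sum_i c i *: Phi T (E i))) (Phi T (E j)) = c j.
  rewrite !(bformDl (hTb x)) !(bformZl (hTb x)) (hT_sym e) Ee hT_xi_Phi !mulr0 !add0r.
  rewrite (_ : \sum_i _ = Phi T (\sum_i c i *: E i)); last first.
    by rewrite Phi_sum; apply: eq_bigr => i _; rewrite PhiZ.
  by rewrite hT_Phi orthonormal_coef.
have [b [bB _]] := hT_lorentzian T x.
have fB : is_basis f.
  apply: is_basis_free bB _ => c; rewrite sumf => c0.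
  apply/rowP => i; rewrite mxE.
  have [j|] := unliftP ord0 i.
    move=> ->; have [k|] := unliftP ord0 j => ->.
      by have := pE (c 0 0) (c 0 (lift 0 0)) (fun i => c 0 (lift 0 (lift 0 i))) k; rewrite c0 (bform0l (hTb x)).
    by have := px (c 0 0) (c 0 (lift 0 0)) (fun i => c 0 (lift 0 (lift 0 i))); rewrite c0 (bform0l (hTb x)).
  by move=> ->; have := pe (c 0 0) (c 0 (lift 0 0)) (fun i => c 0 (lift 0 (lift 0 i))); rewrite c0 (bform0l (hTb x)).
have [c [-> _]] := fB s; rewrite sumf pe px.
rewrite -[in RHS]addrA; congr (_ + _); rewrite addrC; congr (_ + _).
by apply: eq_bigr => i _; rewrite (pE _ _ (fun j => c 0 (lift 0 (lift 0 j)))).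
Qed.

(** Expanding gives e' = h(e', e) xi + e, whose square is 2 h(e', e); nullity removes the multiple
    of [xi]. *)
Lemma null_dual_unique x (E : 'I_m -> tangent x) e e' :
  orthonormal E -> null_dual E e -> null_dual E e' -> e' = e.
Proof.
move=> oE ne [ee' xie' Ee']; have := null_dual_expand e' oE ne.
rewrite big1 => [|i _]; last by rewrite (hT_sym e') Ee' scale0r.
rewrite (hT_sym e' (xi x)) xie' scale1r addr0 => E1.
have : hT e' e' = 0 by []; rewrite {1}E1 (bformDl (hTb x)) (bformZl (hTb x)) xie' (hT_sym e) mulr1.
move=> /eqP; rewrite -mulr2n mulrn_eq0 /= => /eqP e0.
by rewrite E1 e0 scale0r add0r.
Qed.

Lemma hT_dual_ex x : exists s : bun T x, hT (xi x) s = 1.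
Proof.
apply: contrapT => nex.
have [xi0 _] := xi_lightlike T x; move/eqP: xi0; apply.
apply: (lorentzian_nondegenerate (hTb x) (hT_lorentzian T x)) => w.
apply: contrapT => /eqP w0; apply: nex; exists ((hT (xi x) w)^-1 *: w).
by rewrite (bformZr (hTb x)) mulVf.
Qed.

(* The multiple of [xi] cancels [hT s s] without changing the other products,
   because [xi] is null and orthogonal to the image of [Phi]. *)
Definition null_correction x (E : 'I_m -> tangent x) (s : bun T x) : bun T x :=
  s - \sum_i hT s (Phi T (E i)) *: Phi T (E i)
  - ((hT s s - \sum_i hT s (Phi T (E i)) ^+ 2) / 2) *: xi x.

Lemma null_correctionP x (E : 'I_m -> tangent x) s : orthonormal E -> hT (xi x) s = 1 ->
  null_dual E (null_correction E s).
Proof.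
move=> oE xis; rewrite /null_correction.
set c := fun i => hT s (Phi T (E i)).
have -> : \sum_i hT s (Phi T (E i)) *: Phi T (E i) = Phi T (\sum_i c i *: E i).
  by rewrite Phi_sum; apply: eq_bigr => i _; rewrite PhiZ.
set w := \sum_i c i *: E i.
have sw : hT s (Phi T w) = \sum_i c i ^+ 2.
  by rewrite Phi_sum (bform_sumr (hTb x)); apply: eq_bigr => i _; rewrite PhiZ (bformZr (hTb x)).
have ww : hT (Phi T w) (Phi T w) = \sum_i c i ^+ 2.
  rewrite hT_Phi {2}/w (bform_sumr (hNb x)); apply: eq_bigr => i _.
  by rewrite (bformZr (hNb x)) orthonormal_coef.
set q := \sum_i _; set d := _ / 2.
split.
- rewrite !(bformBl (hTb x)) !(bformBr (hTb x)) !(bformZl (hTb x)) !(bformZr (hTb x)).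
  rewrite hT_xi_Phi hT_Phi_xi xi_xi xis (hT_sym s (xi x)) xis (hT_sym (Phi T w) s) sw ww -/q.
  by rewrite /d; field.
- by rewrite !(bformBr (hTb x)) (bformZr (hTb x)) xis xi_xi hT_xi_Phi; ring.
- move=> i; rewrite !(bformBr (hTb x)) (bformZr (hTb x)) hT_Phi_xi hT_Phi (hN_sym (E i)) orthonormal_coef//.
  by rewrite (hT_sym _ s) /c subrr mulr0 subr0.
Qed.

Lemma null_dual_ex x (E : 'I_m -> tangent x) : orthonormal E -> exists e, null_dual E e.
Proof.
by move=> oE; have [s xis] := hT_dual_ex x; exists (null_correction E s); exact: null_correctionP.
Qed.

Section Transverse.
Variables (t : forall x : N, tangent x -> R) (x : N) (E : 'I_m -> tangent x).
Hypothesis (t1 : t (ZN N x) = 1) (tl : scalar (@t x)).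
Hypothesis (tE : forall i, t (E i) = 0) (oE : orthonormal E).

Lemma covectorD v w : t (v + w : tangent x) = t v + t w.
Proof. by have := tl 1 v w; rewrite scale1r mul1r. Qed.

Lemma covector0 : t (0 : tangent x) = 0.
Proof.
have := covectorD 0 0; rewrite addr0 => /eqP.
by rewrite -[X in X == _]addr0 (inj_eq (addrI _)) eq_sym => /eqP.
Qed.

Lemma covectorZ a v : t (a *: v : tangent x) = a * t v.
Proof. by have := tl a v 0; rewrite addr0 covector0 addr0. Qed.

Lemma covector_frame_sum (c : 'I_m -> R) : t (\sum_i c i *: E i) = 0.
Proof.
by elim/big_ind: _ => [|u v u0 v0|i _]; rewrite ?covector0// ?covectorD ?u0 ?v0 ?addr0// covectorZ tE mulr0.
Qed.

(** That these m + 1 vectors span the tangent space comes from the bundle: [Phi T v] is orthogonal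
    to [xi], so its expansion has no [e] term, and [Phi] is injective. *)
Lemma transverse_expand (v : tangent x) : v = t v *: ZN N x + \sum_i hN v (E i) *: E i.
Proof.
have [e ne] := null_dual_ex oE; have := null_dual_expand (Phi T v) oE ne.
rewrite hT_Phi_xi scale0r addr0 -Phi_ZN -PhiZ.
rewrite (_ : \sum_i _ = Phi T (\sum_i hN v (E i) *: E i)); last first.
  by rewrite Phi_sum; apply: eq_bigr => i _; rewrite hT_Phi PhiZ.
rewrite -PhiD => /Phi_inj E1.
by rewrite [in t v]E1 covectorD covectorZ t1 mulr1 covector_frame_sum addr0.
Qed.

Lemma null_dual_t e (v : tangent x) : null_dual E e -> hT (Phi T v) e = t v.
Proof.
move=> [_ xie Ee]; rewrite [in LHS](transverse_expand v) PhiD PhiZ Phi_ZN (bformDl (hTb x)) (bformZl (hTb x)) xie mulr1.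
rewrite Phi_sum (bform_suml (hTb x)) big1 ?addr0// => i _.
by rewrite PhiZ (bformZl (hTb x)) Ee mulr0.
Qed.

Lemma eta_null_dual e : null_dual E e -> Defs.eta T t x = e.
Proof.
move=> ne; have [ee xie Ee] := ne; apply: (null_dual_unique oE ne).
have : [set e' | [/\ lightlike (@hT _ _ _ T x) e', hT (xi x) e' = 1
    & forall v : tangent x, t v = 0 -> hT (Phi T v) e' = 0]] (Defs.eta T t x).
  apply: xgetPex; exists e; split=> //; last by move=> v v0; rewrite (null_dual_t v ne).
  split=> //; apply/eqP => e0; move: xie; rewrite e0 (bform0r (hTb x)) => /eqP.
  by rewrite eq_sym oner_eq0.
by move=> [[_ ee'] xie' Ee']; split=> // i; exact: Ee'.
Qed.

Lemma etaP : null_dual E (Defs.eta T t x).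
Proof. by have [e ne] := null_dual_ex oE; rewrite (eta_null_dual ne). Qed.

Lemma An_compE (s : bun T x) : An_comp t s = \sum_i hT s (Phi T (E i)) *: E i.
Proof.
have [ee xie Ee] := etaP; set w := RHS.
have Pw : Phi T w = \sum_i hT s (Phi T (E i)) *: Phi T (E i).
  by rewrite Phi_sum; apply: eq_bigr => i _; rewrite PhiZ.
have : [set X : tangent x | t X = 0 /\ exists a b, s = a *: xi x + Phi T X + b *: Defs.eta T t x] (An_comp t s).
  apply: xgetPex; exists w; split; first exact: covector_frame_sum.
  by exists (hT s (Defs.eta T t x)), (hT s (xi x)); rewrite Pw; exact: null_dual_expand oE etaP.
move=> [tX [a [b Es]]]; rewrite [LHS]transverse_expand tX scale0r add0r.
apply: eq_bigr => i _; congr (_ *: _).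
rewrite [in RHS]Es !(bformDl (hTb x)) !(bformZl (hTb x)) hT_xi_Phi (hT_sym (Defs.eta T t x)) Ee hT_Phi.
by rewrite !mulr0 addr0 add0r.
Qed.

End Transverse.

End LightlikeExtension.

(** * Frames and transverse forms *)

Section Frames.
Context {R : realType} {m : nat} {N : lightlike_manifold R m}.
Implicit Types (x y : N) (t : forall x : N, tangent x -> R).
Let hNb x := hN_bilinear x.

(** A vector of square 0 lies in the radical, hence is a multiple of [ZN], and [t] kills only the
    zero multiple. *)
Lemma hN_gt0 t x (v : tangent x) : scalar (t x) -> t x (ZN N x) = 1 ->
  t x v = 0 -> v != 0 -> 0 < hN v v.
Proof.
move=> tl t1 tv v0; rewrite lt_neqAle hN_ge0 andbT eq_sym; apply: contra_neq v0 => vv.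
have [Zs _] := ZN_span v; have [a Ea] : exists a, v = a *: ZN N x.
  by apply: Zs; exact: psd_radical (hNb x) _ (@hN_sym _ _ _ x) (@hN_ge0 _ _ _ x) vv.
by move: tv; rewrite Ea (covectorZ tl) t1 mulr1 => ->; rewrite scale0r.
Qed.

Lemma orthonormal_partial t x k : transverse_form t -> (k <= m)%N ->
  exists U (E : nat -> field N), [/\ open U, U x,
    forall i, (i < k)%N -> An_section t (E i)
    & forall y i j, U y -> (i < k)%N -> (j < k)%N -> hN (E i y) (E j y) = (i == j)%:R].
Proof.
move=> [[tl ts] t1]; elim: k => [|k IH] km.
  by exists setT, (fun _ _ => 0); split=> //; exact: openT.
have [U [E [oU Ux AE oE]]] := IH (ltnW km).
have [Dv [u [sD su Du]]] := coordinate_fields x.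
(* The new direction at [x] must satisfy k + 1 linear conditions: [t] vanishes on it and it is
   orthogonal to [k] earlier vectors. The m + 1 coordinate fields leave a nonzero solution because k
   < m. *)
pose B : 'M[R]_(m.+1, k.+1) := \matrix_(i, j)
  if unlift ord0 j is Some l then hN (Dv i x) (E l x) else t x (Dv i x).
have [a a0 aB] : exists2 a : 'rV[R]_m.+1, a != 0 & a *m B = 0.
  have : kermx B != 0.
    rewrite kermx_eq0 /row_free; apply/negP => /eqP rB.
    by have := rank_leq_col B; rewrite rB ltnNge; rewrite km.
  case/rowV0Pn => a ak a0; exists a => //; exact/sub_kermxP.
pose V : field N := fun y => \sum_i a 0 i *: Dv i y.
have sV : smooth_field V.
  by apply: smooth_field_sum => i; apply: smooth_fieldZ => //; exact: smooth_cst.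
have Vx0 : V x != 0.
  apply: contra_neq a0 => V0; apply/rowP => j; rewrite mxE.
  have : V x (u j) = 0 by rewrite V0.
  rewrite /V tangent_sumE (bigD1 j)//= big1 => [|i ij]; last first.
    by transitivity (a 0 i * Dv i x (u j)); [by []|rewrite Du (negbTE ij) mulr0].
  rewrite addr0 => <-; transitivity (a 0 j * Dv j x (u j)); [|by []].
  by rewrite Du eqxx mulr1.
have tsum y (I : Type) (r : seq I) (F : I -> tangent y) :
    t y (\sum_(i <- r) F i) = \sum_(i <- r) t y (F i).
  by elim: r => [|i r IHr]; rewrite ?big_nil ?(covector0 (tl y))// !big_cons (covectorD (tl y)) IHr.
have tV : t x (V x) = 0.
  have /rowP/(_ ord0) := aB; rewrite !mxE => aB0; rewrite /V tsum -[RHS]aB0.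
  by apply: eq_bigr => i _; rewrite (covectorZ (tl x)) mxE unlift_none.
have EV l : (l < k)%N -> hN (V x) (E l x) = 0.
  move=> lk; have /rowP/(_ (lift ord0 (Ordinal lk))) := aB; rewrite !mxE => aB0.
  rewrite /V (bform_suml (hNb x)) -[RHS]aB0.
  by apply: eq_bigr => i _; rewrite (bformZl (hNb x)) mxE liftK.
(* [W] lies in the kernel of [t] everywhere but is orthogonal to the earlier fields only on [U]; at
   [x] both corrections vanish, so [W] is nonzero there. *)
pose W : field N := fun y => V y - t y (V y) *: ZN N y - \sum_(i < k) hN (V y) (E i y) *: E i y.
have sE (i : 'I_k) : smooth_field (E i) by have [] := AE i (ltn_ord i).
have sW : smooth_field W.
  apply: smooth_fieldB; first apply: smooth_fieldB => //.
    by apply: smooth_fieldZ; [exact: ts|exact: ZN_smooth].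
  apply: smooth_field_sum => i; apply: smooth_fieldZ => //.
  exact: hN_smooth.
have tW y : t y (W y) = 0.
  have tBr v w : t y (v - w) = t y v - t y w.
    by rewrite (covectorD (tl y)) -scaleN1r (covectorZ (tl y)) mulN1r.
  rewrite /W !tBr (covectorZ (tl y)) t1 mulr1 subrr tsum big1 ?subr0// => i _.
  by rewrite (covectorZ (tl y)); have [_ ->] := AE i (ltn_ord i); rewrite mulr0.
have EW y l : U y -> (l < k)%N -> hN (W y) (E l y) = 0.
  move=> Uy lk; rewrite /W; move: (V y) => v.
  rewrite !(bformBl (hNb y)) (bformZl (hNb y)) hN_ZNl mulr0 subr0.
  rewrite (bform_suml (hNb y)) (bigD1 (Ordinal lk))//= big1 => [|i il].
    by rewrite (bformZl (hNb y)) oE// eqxx mulr1 addr0 subrr.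
  rewrite (bformZl (hNb y)) oE//; case: eqP => [il0|_]; last by rewrite mulr0.
  by case/eqP: il; apply: val_inj.
have Wx : W x = V x.
  rewrite /W tV scale0r subr0 big1 ?subr0// => i _; by rewrite EV// scale0r.
have f0 : 0 < hN (W x) (W x) by apply: (hN_gt0 (tl x) (t1 x)); rewrite Wx.
have sf : smooth (fun y => hN (W y) (W y)) by exact: hN_smooth.
have [g [G [sg g0 oG Gx gE]]] := positive_extension sf f0.
(* The inverse length of [W], correct only where [g] equals its square length but smooth
   everywhere. *)
pose q y := g y `^ (- 2^-1).
have sq : smooth q by exact: smooth_powR.
have qq y : q y * (q y * g y) = 1.
  have q2 : q y * q y = (g y)^-1.
    rewrite /q -powRD; last by rewrite (gt_eqF (g0 y)) implybT.
    rewrite (_ : - 2^-1 - 2^-1 = -1 :> R); last by field.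
    exact/powR_inv1/ltW.
  by rewrite mulrA q2 mulVf// gt_eqF.
pose E' i : field N := if i == k then fun y => q y *: W y else E i.
have E'k : E' k = fun y => q y *: W y by rewrite /E' eqxx.
have E'l l : (l < k)%N -> E' l = E l by move=> lk; rewrite /E' ltn_eqF.
exists (U `&` G), E'; split=> //; first exact: openI.
  move=> i; rewrite ltnS leq_eqVlt => /orP[/eqP->|ik]; last by rewrite E'l//; exact: AE.
  rewrite E'k; split; first exact: smooth_fieldZ.
  by move=> y; rewrite (covectorZ (tl y)) tW mulr0.
move=> y i j [Uy Gy]; rewrite !ltnS (leq_eqVlt i) (leq_eqVlt j) => /orP[/eqP->|ik] /orP[/eqP->|jk].
- rewrite E'k (bformZl (hNb y)) (bformZr (hNb y)) -gE// qq eqxx//.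
- by rewrite E'k E'l// (bformZl (hNb y)) EW// mulr0 gtn_eqF.
- by rewrite E'k E'l// (bformZr (hNb y)) hN_sym EW// mulr0 ltn_eqF.
- by rewrite !E'l// oE.
Qed.

Lemma orthonormal_frame_ex t x : transverse_form t ->
  exists U (E : 'I_m -> field N), orthonormal_frame t U E /\ U x.
Proof.
move=> tt; have [U [E [oU Ux AE oE]]] := orthonormal_partial x tt (leqnn m).
exists U, (fun i => E i); split=> //; split=> // [i|y i j Uy]; first exact: AE.
by rewrite oE.
Qed.

End Frames.

(** * Smoothness of the splitting and existence of a transverse form *)

Section Smoothness.
Context {R : realType} {m : nat} {N : lightlike_manifold R m}.
Variable T : lightlike_extension N.
Hypothesis hfor : extension_for T.
Implicit Types (x y : N) (t : forall x : N, tangent x -> R).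
Let hTb x := hT_bilinear T x.
Let hNb x := hN_bilinear x.
Local Notation xi := (xi T).

(** Nondegeneracy provides a frame vector not orthogonal to [xi] at [x], which is cut off and
    rescaled. The pairing is recorded on all of [N] as [rho], since the gluing needs its values away
    from [x] too. *)
Lemma local_dual x : exists (s : section (bun T)) (rho : N -> R) V,
  [/\ smooth_section s, smooth rho, forall y, hT (xi y) (s y) = rho y, open V & V x] /\
  (forall y, V y -> rho y = 1).
Proof.
have [F fF Fx] := frame_cover (bun T) x.
have [psi [V [Q [] [sp oV Vx VF] [oQ QF p1 p0]]]] := bump_function (frame_open fF) Fx.
have [j xj] : exists j, hT (xi x) (fvec F j x) != 0.
  apply: contrapT => nj.
  have [xi0 _] := xi_lightlike T x; move/eqP: xi0; apply.
  apply: (lorentzian_nondegenerate (hTb x) (hT_lorentzian T x)) => w.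
  have [a [-> _]] := frame_basis fF Fx w.
  rewrite (bform_sumr (hTb x)) big1// => j _; rewrite (bformZr (hTb x)).
  have [->|xj] := eqVneq (hT (xi x) (fvec F j x)) 0; first by rewrite mulr0.
  by case: nj; exists j.
pose s0 : section (bun T) := fun y => psi y *: fvec F j y.
have ss0 : smooth_section s0 by exact: smooth_section_frame oQ QF sp p0.
pose g y := hT (xi y) (s0 y).
have sg : smooth g by apply: hT_smooth => //; exact: xi_smooth.
have g20 : 0 < g x * g x.
  by rewrite -expr2 lt_neqAle sqr_ge0 andbT eq_sym expf_neq0// /g /s0 (bformZr (hTb x)) p1// mul1r.
have [G [W [sG G0 oW Wx GE]]] := positive_extension (smoothM sg sg) g20.
have sGi : smooth (fun y => G y `^ (-1)) by exact: smooth_powR.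
(* Near [x] this is g / g^2 = 1 / g; the square is inverted because [g] may be negative at [x]. *)
pose c y := G y `^ (-1) * g y.
have sc : smooth c by exact: smoothM.
exists (fun y => c y *: s0 y), (fun y => c y * g y), W; split; last first.
  by move=> y Wy; rewrite /c -mulrA -GE// powR_inv1 ?ltW// mulVf// gt_eqF.
split=> //; first exact: smooth_sectionZ.
  exact: smoothM.
by move=> y; rewrite (bformZr (hTb y)).
Qed.

Lemma smooth_PhiS (V : field N) : smooth_field V -> smooth_section (PhiS T V).
Proof. by move=> sV; apply: cov_smooth => //; exact: xi_smooth. Qed.

(** By uniqueness [eta] agrees locally with [null_correction], an explicit smooth expression in a
    local dual section and an orthonormal frame. *)
Lemma eta_smooth t : transverse_form t -> smooth_section (Defs.eta T t).
Proof.
move=> tt; apply: smooth_section_local => x.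
have [[tl ts] t1] := tt.
have [U [E [[oU AE oE] Ux]]] := orthonormal_frame_ex x tt.
have [s [rho [V [[ss srho xis oV Vx] r1]]]] := local_dual x.
exists (U `&` V); first exact: openI.
split=> //.
pose e : section (bun T) := fun y => null_correction (fun i => E i y) (s y).
exists e.
  have sE i : smooth_section (PhiS T (E i)) by apply: smooth_PhiS; have [] := AE i.
  have sh i : smooth (fun y => hT (s y) (Phi T (E i y))) by exact: (hT_smooth ss (sE i)).
  apply: smooth_sectionD; first apply: smooth_sectionD => //.
    by apply: smooth_sectionN; apply: smooth_section_sum => i; exact: (smooth_sectionZ (sh i) (sE i)).
  apply: smooth_sectionN; apply: smooth_sectionZ; last exact: xi_smooth.
  apply: smoothM; last exact: smooth_cst.
  apply: smoothB; first exact: hT_smooth.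
  by apply: smooth_sum => i; under eq_fun do rewrite expr2; exact: smoothM.
move=> y [Uy Vy]; apply: (eta_null_dual hfor (t1 y) (tl y) (E := fun i => E i y)).
- by move=> i; have [_] := AE i.
- by move=> i j; exact: oE.
- apply: null_correctionP => //; first by move=> i j; exact: oE.
  by rewrite xis r1.
Qed.

Lemma An_comp_smooth t (s : section (bun T)) : transverse_form t -> smooth_section s ->
  smooth_field (fun y => An_comp t (s y)).
Proof.
move=> tt ss; apply: smooth_field_local => x.
have [[tl ts] t1] := tt.
have [U [E [[oU AE oE] Ux]]] := orthonormal_frame_ex x tt.
exists U => //; split=> //.
exists (fun y => \sum_i hT (s y) (Phi T (E i y)) *: E i y).
  apply: smooth_field_sum => i; apply: smooth_fieldZ; last by have [] := AE i.
  by apply: hT_smooth => //; apply: smooth_PhiS; have [] := AE i.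
move=> y Uy; apply: (An_compE hfor (t1 y) (tl y) (E := fun i => E i y)).
  by move=> i; have [_] := AE i.
by move=> i j; exact: oE.
Qed.

(* On the set where [rho n = 1] only the first [n.+1] terms of the sum
   [\sum_k (\prod_(j < k) (1 - rho j)) *: s k] survive, so it is smooth without
   any appeal to local finiteness. *)
Lemma dual_section_ex : exists2 S : section (bun T),
  smooth_section S & forall y, hT (xi y) (S y) = 1.
Proof.
have [B cB bB] := man_countable N.
have /countable_injP[f finj] := cB.
pose good (b : set N) (p : section (bun T) * (N -> R)) :=
  [/\ smooth_section p.1, smooth p.2, forall y, hT (xi y) (p.1 y) = p.2 y
    & forall y, b y -> p.2 y = 1].
(* Injectivity of the numbering [f] makes the basic open set with number [n] unique. If there is
   none, or it admits no good pair, the zero pair is stored and contributes nothing to the sum. *)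
have /choice[p Hp] : forall n, exists p : section (bun T) * (N -> R),
    [/\ smooth_section p.1, smooth p.2, forall y, hT (xi y) (p.1 y) = p.2 y
      & forall b, B b -> f b = n -> (exists q, good b q) -> forall y, b y -> p.2 y = 1].
  move=> n; have [[b [Bb fb [q [q1 q2 q3 q4]]]]|nb] :=
      pselect (exists b, [/\ B b, f b = n & exists q, good b q]).
    exists q; split=> // b' Bb' fb' _; have -> : b' = b by apply: finj; rewrite ?inE// fb fb'.
    exact: q4.
  exists (fun=> 0, fun=> 0); split=> //=; first exact: smooth_section0.
  - exact: smooth_cst.
  - by move=> y; rewrite (bform0r (hTb y)).
  - by move=> b Bb fb gb; case: nb; exists b.
have cover x : exists n V, [/\ open V, V x & forall y, V y -> (p n).2 y = 1].
  have [s [rho [V [[ss srho xis oV Vx] r1]]]] := local_dual x.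
  have [oB bx] := bB; have [b [[Bb bbx] bV]] : exists b, (B b /\ b x) /\ b `<=` V.
    have : nbhs x V by apply: open_nbhs_nbhs.
    by move=> /bx[b [Bb xb] bV]; exists b.
  exists (f b), b; split=> //; first exact: oB.
  have [_ _ _ pb] := Hp (f b).
  by apply: pb => //; exists (s, rho); split=> // y /bV; exact: r1.
pose w k y := \prod_(j < k) (1 - (p j).2 y).
pose P k : section (bun T) := fun y => \sum_(j < k) w j y *: (p j).1 y.
have sw k : smooth (w k).
  elim: k => [|k IH].
    by rewrite (_ : w 0%N = fun=> 1); [exact: smooth_cst|apply/funext => y; rewrite /w big_ord0].
  rewrite (_ : w k.+1 = fun y => w k y * (1 - (p k).2 y)); last first.
    by apply/funext => y; rewrite /w big_ord_recr.
  by apply: smoothM => //; apply: smoothB; [exact: smooth_cst|have [] := Hp k].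
have sP k : smooth_section (P k).
  by apply: smooth_section_sum => j; apply: smooth_sectionZ => //; have [] := Hp j.
(* Telescoping: the k-th term contributes w k times the k-th weight, that is, w k - w (k + 1). *)
have xiP k y : hT (xi y) (P k y) = 1 - w k y.
  elim: k => [|k IH]; first by rewrite /P /w !big_ord0 (bform0r (hTb y)) subrr.
  have -> : P k.+1 y = P k y + w k y *: (p k).1 y by rewrite /P big_ord_recr.
  have [_ _ -> _] : [/\ smooth_section (p k).1, smooth (p k).2,
      hT (xi y) (P k y + w k y *: (p k).1 y) = 1 - w k y + w k y * (p k).2 y & True].
    by have [? ? H _] := Hp k; split=> //; rewrite (bformDr (hTb y)) (bformZr (hTb y)) IH H.
  by rewrite /w big_ord_recr /=; ring.
have w0 n y k : (p n).2 y = 1 -> (n < k)%N -> w k y = 0.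
  by move=> pn nk; rewrite /w (bigD1 (Ordinal nk))//= pn subrr mul0r.
have Pstable n y k : (p n).2 y = 1 -> (n < k)%N -> P k y = P n.+1 y.
  move=> pn; elim: k => // k IH; rewrite ltnS leq_eqVlt => /orP[/eqP->//|nk].
  have -> : P k.+1 y = P k y + w k y *: (p k).1 y by rewrite /P big_ord_recr.
  by rewrite (w0 n)// scale0r addr0 IH.
(* [K] has no regularity, but by [Pstable] any index of weight 1 at the point gives the same value,
   so near a point a fixed partial sum can be used. *)
have /choice[K HK] : forall x, exists n, (p n).2 x = 1.
  by move=> x; have [n [V [_ Vx pV]]] := cover x; exists n; exact: pV.
have SE n y : (p n).2 y = 1 -> P (K y).+1 y = P n.+1 y.
  move=> pn; have [nK|Kn|->//] := ltngtP n (K y).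
    exact: Pstable (ltnW _).
  by rewrite [RHS](@Pstable (K y))// ltnW.
exists (fun y => P (K y).+1 y); last by move=> y; rewrite xiP (w0 (K y))// subr0.
apply: smooth_section_local => x; have [n [V [oV Vx pV]]] := cover x.
by exists V => //; split=> //; exists (P n.+1) => // y Vy; apply: SE; exact: pV.
Qed.

(** Pairing [Phi] with the dual section gives a one-form with value 1 on [ZN] because [Phi] sends
    [ZN] to [xi]. *)
Lemma transverse_form_ex : exists t : forall x : N, tangent x -> R, transverse_form t.
Proof.
have [S sS xiS] := dual_section_ex.
exists (fun x v => hT (Phi T v) (S x)); split; last by move=> x; rewrite Phi_ZN.
split=> [x a v w|V sV]; last exact: (hT_smooth (smooth_PhiS sV) sS).
by rewrite PhiD PhiZ (bformDl (hTb x)) (bformZl (hTb x)).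
Qed.

End Smoothness.

(** * Tensoriality and the trace *)

(** [is_trace] allows any basis, so invariance under change of basis has to be proved. Linearity of
    [A] is encoded in its values on combinations of [e], because [weyl], defined by choice, is not
    known to be linear beforehand. *)
Lemma is_trace_basis (R : realType) (V : lmodType R) k (e : 'I_k -> V) (A : V -> V)
    (B : 'M[R]_k) c : is_basis e ->
  (forall a : 'I_k -> R, A (\sum_i a i *: e i) = \sum_i \sum_j (a i * B i j) *: e j) ->
  is_trace k A c <-> \tr B = c.
Proof.
move=> eB AE; have eu (a b : 'I_k -> R) : \sum_i a i *: e i = \sum_i b i *: e i -> a =1 b.
  move=> ab i; have [d [_ du]] := eB (\sum_i a i *: e i).
  have da : d = \row_i a i by apply: du; apply: eq_bigr => j _; rewrite mxE.
  have db : d = \row_i b i by apply: du; rewrite ab; apply: eq_bigr => j _; rewrite mxE.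
  have /rowP/(_ i) : \row_i a i = \row_i b i by rewrite -da -db.
  by rewrite !mxE.
split=> [[f [a [fB fA <-]]]|<-]; last first.
  exists e, B; split=> // i; have := AE (fun j => (j == i)%:R).
  rewrite (bigD1 i)//= eqxx scale1r big1 ?addr0 => [|j ji]; last by rewrite (negbTE ji) scale0r.
  move=> ->; rewrite [LHS](bigD1 i)//= [X in _ + X]big1 ?addr0 => [|j ji]; last first.
    by apply: big1 => l _; rewrite (negbTE ji) mul0r scale0r.
  by apply: eq_bigr => j _; rewrite eqxx mul1r.
have /choice[p Hp] : forall i, exists r : 'rV[R]_k, f i = \sum_j r 0 j *: e j.
  by move=> i; have [r [Er _]] := eB (f i); exists r.
have /choice[q Hq] : forall i, exists r : 'rV[R]_k, e i = \sum_j r 0 j *: f j.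
  by move=> i; have [r [Er _]] := fB (e i); exists r.
pose P := \matrix_i p i; pose Q := \matrix_i q i.
have QP : Q *m P = 1%:M.
  apply/matrixP => i j; rewrite !mxE.
  apply: (eu (fun j => \sum_l Q i l * P l j) (fun j => (i == j)%:R)).
  rewrite [RHS](bigD1 i)//= eqxx scale1r [X in _ + X]big1 ?addr0 => [|l]; last first.
    by rewrite eq_sym => /negbTE->; rewrite scale0r.
  rewrite [RHS]Hq; under [RHS]eq_bigr => l _ do rewrite Hp scaler_sumr.
  rewrite exchange_big; apply: eq_bigr => l _; rewrite scaler_suml.
  by apply: eq_bigr => l' _; rewrite scalerA !mxE.
have aPB : a *m P = P *m B.
  apply/matrixP => i j; rewrite !mxE.
  apply: (eu (fun j => \sum_l a i l * P l j) (fun j => \sum_l P i l * B l j)).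
  transitivity (A (f i)).
    rewrite fA; under [RHS]eq_bigr => l _ do rewrite Hp scaler_sumr.
    rewrite [RHS]exchange_big; apply: eq_bigr => l _; rewrite scaler_suml.
    by apply: eq_bigr => l' _; rewrite scalerA !mxE.
  rewrite Hp (AE (p i 0)) exchange_big; apply: eq_bigr => l _; rewrite scaler_suml.
  by apply: eq_bigr => l' _; rewrite !mxE.
have -> : B = Q *m a *m P by rewrite -mulmxA aPB mulmxA QP mul1mx.
by rewrite -mulmxA mxtrace_mulC -mulmxA (mulmx1C QP) mulmx1.
Qed.

(** * Curvature modulo the radical *)

Section Curvature.
Context {R : realType} {m : nat} {N : lightlike_manifold R m}.
Variable T : lightlike_extension N.
Hypothesis hfor : extension_for T.
Implicit Types (x y : N) (t : forall x : N, tangent x -> R) (U V W X Y A B C : field N).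
Let hTb x := hT_bilinear T x.
Let hNb x := hN_bilinear x.
Local Notation xi := (xi T).
Local Notation RT := (RT (T := T)).
Let sxi : smooth_section xi := @xi_smooth _ _ _ T.

(** The bracket identity is applied to the function h(s, u): after two uses of metricity the mixed
    products of first derivatives cancel. *)
Lemma RT_skew V W (s u : section (bun T)) x : smooth_field V -> smooth_field W ->
  smooth_section s -> smooth_section u ->
  hT (RT V W s x) (u x) + hT (s x) (RT V W u x) = 0.
Proof.
move=> sV sW ss su.
have sf : smooth (fun y => hT (s y) (u y)) by exact: hT_smooth.
have EX X : apply_field X (fun y => hT (s y) (u y)) =
    fun y => hT (cov (nab T) (X y) s) (u y) + hT (s y) (cov (nab T) (X y) u).
  by apply/funext => y; rewrite /apply_field nab_metric.
have sc X v : smooth_field X -> smooth_section v -> smooth_section (fun y => cov (nab T) (X y) v).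
  by move=> sX sv; exact: cov_smooth.
have := bracketE x (fun y => hT (s y) (u y)) sV sW.
rewrite !EX nab_metric// !tangentD; try by apply: hT_smooth => //; exact: sc.
rewrite !nab_metric//; try exact: sc.
rewrite /Defs.RT /curvature !(bformBl (hTb x)) !(bformBr (hTb x)) => E1.
apply/eqP; rewrite addrC addr_eq0; apply/eqP; move: E1.
set p1 := hT (cov _ (bracket V W x) s) _; set p2 := hT _ (cov _ (bracket V W x) u).
by move=> E1; rewrite (_ : p2 = (p1 + p2) - p1); [rewrite E1; ring|ring].
Qed.

(** The coefficients t(V) and h(V, E_j) are smooth on all of [N], although they expand [V] only on
    [U], and being linear in [V] they vanish wherever [V] does: the input for tensoriality. *)
Lemma local_basis x : exists (U : set N) (B : 'I_m.+1 -> field N),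
  [/\ open U, U x, forall i, smooth_field (B i) &
  forall V, smooth_field V -> exists c : 'I_m.+1 -> N -> R,
    [/\ forall i, smooth (c i), forall y, U y -> V y = \sum_i c i y *: B i y
      & V x = 0 -> forall i, c i x = 0]].
Proof.
have [t tt] := transverse_form_ex hfor; have [[tl ts] t1] := tt.
have [U [E [[oU AE oE] Ux]]] := orthonormal_frame_ex x tt.
exists U, (fun i => if unlift ord0 i is Some j then E j else ZN N).
split=> // [i|V sV]; first by case: unlift => [j|]; [have [] := AE j|exact: ZN_smooth].
exists (fun i => if unlift ord0 i is Some j then fun y => hN (V y) (E j y) else fun y => t y (V y)).
split=> [i|y Uy|V0 i].
- case: unlift => [j|]; last exact: ts.
  by apply: hN_smooth => //; have [] := AE j.
- rewrite big_ord_recl unlift_none; under eq_bigr => i _ do rewrite liftK.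
  apply: (transverse_expand hfor (t1 y) (tl y) (E := fun i => E i y)).
    by move=> i; have [_] := AE i.
  by move=> i j; exact: oE.
- by case: unlift => [j|]; rewrite V0 ?(bform0l (hNb x))// (covector0 (tl x)).
Qed.

Lemma RT_vanish V W (s : section (bun T)) x : smooth_field V -> smooth_field W ->
  smooth_section s -> V x = 0 -> RT V W s x = 0.
Proof.
move=> sV sW ss V0; have [U [B [oU Ux sB HB]]] := local_basis x.
have [c [sc VE /(_ V0) c0]] := HB V sV.
exact: (curvature_vanish _ oU Ux sV sW ss sB sc VE c0).
Qed.

Lemma RT_vanish_Phi V W X x : smooth_field V -> smooth_field W ->
  smooth_field X -> X x = 0 -> RT V W (PhiS T X) x = 0.
Proof.
move=> sV sW sX X0; have [U [B [oU Ux sB HB]]] := local_basis x.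
have [c [sc XE /(_ X0) c0]] := HB X sX.
apply: (@curvature_vanish_section _ _ _ _ _ (nab T) _ (fun i => PhiS T (B i)) c V W _ x U) => //.
- exact: smooth_PhiS.
- by move=> i; exact: smooth_PhiS.
- move=> y Uy; rewrite /PhiS XE// Phi_sum; apply: eq_bigr => i _; exact: PhiZ.
Qed.

Lemma cls_eqP x (v w : tangent x) : cls v = cls w <-> exists a, v - w = a *: ZN N x.
Proof.
rewrite /cls lmod_class_eq unfold_in; split=> [/asboolP|] H.
  by have [+ _] := ZN_span (v - w); exact.
by apply/asboolP; have [_] := ZN_span (v - w); exact.
Qed.

Lemma cls_sum x (I : Type) (r : seq I) (c : I -> R) (v : I -> tangent x) :
  cls (\sum_(i <- r) c i *: v i) = \sum_(i <- r) c i *: cls (v i).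
Proof.
elim: r => [|i r IH]; last by rewrite !big_cons -IH /cls lmod_classD lmod_classZ.
by rewrite !big_nil -(scale0r (0 : tangent x)) /cls lmod_classZ; exact: scale0r.
Qed.

Hypothesis hxi : forall V W, smooth_field V -> smooth_field W -> collinear_xi (RT V W xi).
Hypothesis hZ : forall V W, smooth_field V -> smooth_field W ->
  collinear_xi (RT (ZN N) V (PhiS T W)).

(** Skew-symmetry moves the curvature onto [xi], where it is collinear with [xi], hence orthogonal
    to the image of [Phi]. This is what makes [Phi_inv] meaningful in [weyl]. *)
Lemma RT_Phi_xi U V W x : smooth_field U -> smooth_field V -> smooth_field W ->
  hT (RT U V (PhiS T W) x) (xi x) = 0.
Proof.
move=> sU sV sW; have := RT_skew x sU sV (smooth_PhiS (T := T) sW) sxi.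
have [f ->] := hxi sU sV.
by rewrite (bformZr (hTb x)) hT_Phi_xi// mulr0 addr0.
Qed.

(** The relation U = U' + a Z holds at [x] only, so the difference is a field vanishing at [x],
    killed by tensoriality; the [Z] term is collinear with [xi] and pairs to 0 with [Phi T C]. *)
Lemma RT_cls_l U U' V W x (C : tangent x) : smooth_field U -> smooth_field U' ->
  smooth_field V -> smooth_field W -> cls (U x) = cls (U' x) ->
  hT (RT U V (PhiS T W) x) (Phi T C) = hT (RT U' V (PhiS T W) x) (Phi T C).
Proof.
move=> sU sU' sV sW /cls_eqP[a Ua].
have sP := smooth_PhiS (T := T) sW; have sZ := @ZN_smooth _ _ N.
have sa : smooth_field (fun y => a *: ZN N y) by apply: smooth_fieldZ => //; exact: smooth_cst.
pose X : field N := fun y => U y - U' y - a *: ZN N y.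
have sX : smooth_field X by apply: smooth_fieldB => //; exact: smooth_fieldB.
have UE : U = fun y => X y + (U' y + a *: ZN N y).
  by apply/functional_extensionality_dep => y; rewrite /X [U' y + _]addrC addrA !subrK.
have -> : RT U V (PhiS T W) x = RT X V (PhiS T W) x +
    (RT U' V (PhiS T W) x + a *: RT (ZN N) V (PhiS T W) x).
  rewrite {1}UE /Defs.RT curvatureDl//; last exact: smooth_fieldD.
  rewrite curvatureDl// (@curvatureZl _ _ _ _ _ (nab T) (fun=> a))//; exact: smooth_cst.
rewrite RT_vanish// ?add0r; last by rewrite /X Ua subrr.
have [f ->] := hZ sV sW.
by rewrite (bformDl (hTb x)) !(bformZl (hTb x)) hT_xi_Phi// !mulr0 addr0.
Qed.

(** The second slot follows from the first by antisymmetry. In the third slot a multiple of [ZN]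
    becomes a multiple of [xi] under [Phi], and the hypothesis on the curvature of [xi] applies. *)
Lemma RT_cls U U' V V' W W' x (C : tangent x) : smooth_field U -> smooth_field U' ->
  smooth_field V -> smooth_field V' -> smooth_field W -> smooth_field W' ->
  cls (U x) = cls (U' x) -> cls (V x) = cls (V' x) -> cls (W x) = cls (W' x) ->
  hT (RT U V (PhiS T W) x) (Phi T C) = hT (RT U' V' (PhiS T W') x) (Phi T C).
Proof.
move=> sU sU' sV sV' sW sW' UU VV /cls_eqP[a Wa].
rewrite (RT_cls_l C sU sU' sV sW UU) /Defs.RT.
rewrite curvatureC//; last exact: smooth_PhiS.
rewrite (bformNl (hTb x)) (RT_cls_l C sV sV' sU' sW VV) -(bformNl (hTb x)) /Defs.RT -curvatureC//; last exact: smooth_PhiS.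
have sZ := @ZN_smooth _ _ N.
have sa : smooth_field (fun y => a *: ZN N y) by apply: smooth_fieldZ => //; exact: smooth_cst.
pose X : field N := fun y => W y - W' y - a *: ZN N y.
have sX : smooth_field X by apply: smooth_fieldB => //; exact: smooth_fieldB.
have WE : PhiS T W = fun y => PhiS T X y + (PhiS T W' y + a *: xi y).
  apply/functional_extensionality_dep => y.
  by rewrite /PhiS -Phi_ZN// -PhiZ -!PhiD /X [W' y + _]addrC addrA !subrK.
have sPX := smooth_PhiS (T := T) sX; have sPW := smooth_PhiS (T := T) sW'.
have sax : smooth_section (fun y => a *: xi y) by apply: smooth_sectionZ => //; exact: smooth_cst.
have -> : curvature (nab T) U' V' (PhiS T W) x = RT U' V' (PhiS T X) x +
    (RT U' V' (PhiS T W') x + a *: RT U' V' xi x).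
  rewrite {1}WE /Defs.RT curvatureDs//; last exact: smooth_sectionD.
  rewrite curvatureDs// (@curvatureZs _ _ _ _ _ (nab T) (fun=> a))//; exact: smooth_cst.
rewrite RT_vanish_Phi// ?add0r; last by rewrite /X Wa subrr.
have [f ->] := hxi sU' sV'.
by rewrite (bformDl (hTb x)) !(bformZl (hTb x)) hT_xi_Phi// !mulr0 addr0.
Qed.

Lemma cls_Phi_inv x (E : 'I_m -> tangent x) (s : bun T x) : orthonormal E ->
  hT s (xi x) = 0 ->
  cls (Phi_inv s) = \sum_j hT s (Phi T (E j)) *: cls (E j).
Proof.
move=> oE s0; have [e ne] := null_dual_ex hfor oE.
have := null_dual_expand hfor s oE ne; rewrite s0 scale0r addr0 => Es.
have sP : s = Phi T (hT s e *: ZN N x + \sum_j hT s (Phi T (E j)) *: E j).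
  by rewrite PhiD PhiZ Phi_ZN// Phi_sum [LHS]Es; congr (_ + _); apply: eq_bigr => j _; rewrite PhiZ.
rewrite {1}sP PhiK -cls_sum; apply/cls_eqP; exists (hT s e).
by rewrite addrK.
Qed.

(** The set from which [weyl] selects contains the value computed with the given fields, and by
    [RT_cls] all its members have the same coefficients. *)
Lemma weylE U V W x (E : 'I_m -> tangent x) : orthonormal E ->
  smooth_field U -> smooth_field V -> smooth_field W ->
  weyl T (cls (U x)) (cls (V x)) (cls (W x)) =
  \sum_j hT (RT U V (PhiS T W) x) (Phi T (E j)) *: cls (E j).
Proof.
move=> oE sU sV sW; rewrite /weyl.
set S := [set d | _]; have : S (xget 0 S).
  by apply: xgetPex; exists (cls (Phi_inv (RT U V (PhiS T W) x))); exists U, V, W.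
move=> [U' [V' [W' [[sU' sV' sW'] [UU VV WW ->]]]]].
rewrite (cls_Phi_inv oE); last exact: RT_Phi_xi.
by apply: eq_bigr => j _; rewrite (RT_cls (E j) sU' sU sV' sV sW' sW UU VV WW).
Qed.

Lemma cls_basis t x (E : 'I_m -> tangent x) : scalar (t x) -> t x (ZN N x) = 1 ->
  (forall i, t x (E i) = 0) -> orthonormal E -> is_basis (fun i => cls (E i)).
Proof.
move=> tl t1 tE oE q; have [v ->] := lmod_class_surj q.
exists (\row_i hN v (E i)); split=> [|a].
  rewrite -/(cls v) -cls_sum; apply/cls_eqP; exists (t x v).
  rewrite {1}(transverse_expand hfor t1 tl tE oE v); apply/eqP; rewrite subr_eq; apply/eqP.
  by congr (_ + _); apply: eq_bigr => i _; rewrite mxE.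
rewrite -/(cls v) -cls_sum => /cls_eqP[b vb]; apply/rowP => i; rewrite mxE.
move/eqP: vb; rewrite subr_eq => /eqP->.
by rewrite (bformDl (hNb x)) (bformZl (hNb x)) hN_ZNl mulr0 add0r orthonormal_coef.
Qed.

Lemma is_trace_weyl t (E : 'I_m -> field N) V W x c : transverse_form t ->
  (forall i, An_section t (E i)) -> orthonormal (fun i => E i x) ->
  smooth_field V -> smooth_field W ->
  is_trace m (fun u : EN x => weyl T u (cls (V x)) (cls (W x))) c <->
  \sum_i hT (RT (E i) V (PhiS T W) x) (Phi T (E i x)) = c.
Proof.
move=> [[tl ts] t1] AE oE sV sW.
have eB := cls_basis (tl x) (t1 x) (fun i => (AE i).2 x) oE.
pose B : 'M[R]_m := \matrix_(i, j) hT (RT (E i) V (PhiS T W) x) (Phi T (E j x)).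
have -> : \sum_i hT (RT (E i) V (PhiS T W) x) (Phi T (E i x)) = \tr B.
  by apply: eq_bigr => i _; rewrite mxE.
apply: (is_trace_basis _ eB) => a.
have sE i : smooth_field (E i) by have [] := AE i.
have saE i : smooth_field (fun y => a i *: E i y).
  by apply: smooth_fieldZ => //; exact: smooth_cst.
rewrite -cls_sum (weylE (U := fun y => \sum_i a i *: E i y) oE)//; last exact: smooth_field_sum.
rewrite exchange_big; apply: eq_bigr => j _; rewrite /Defs.RT curvature_suml//; last exact: smooth_PhiS.
rewrite (bform_suml (hTb x)) scaler_suml; apply: eq_bigr => i _; rewrite mxE.
rewrite (@curvatureZl _ _ _ _ _ (nab T) (fun=> a i))//; [|exact: smooth_cst|exact: smooth_PhiS].
by rewrite (bformZl (hTb x)).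
Qed.

End Curvature.

(** * Curvature in the splitting defined by a transverse form *)

Section Splitting.
Context {R : realType} {m : nat} {N : lightlike_manifold R m}.
Variable T : lightlike_extension N.
Hypothesis hfor : extension_for T.
Implicit Types (x y : N) (U V W X Y A B C : field N).
Let hTb x := hT_bilinear T x.
Let hNb x := hN_bilinear x.
Local Notation xi := (xi T).
Local Notation RT := (RT (T := T)).
Let sxi : smooth_section xi := @xi_smooth _ _ _ T.

Variable t : forall x : N, tangent x -> R.
Hypothesis tt : transverse_form t.
Local Notation eta := (Defs.eta T t).
Local Notation D := (D_An T t).
Local Notation nab := (nab T).

Lemma null_dual_eta x : exists E : 'I_m -> tangent x,
  [/\ orthonormal E, forall i, t (E i) = 0, null_dual E (eta x)
    & forall s : bun T x, An_comp t s = \sum_i hT s (Phi T (E i)) *: E i].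
Proof.
have [[tl ts] t1] := tt.
have [U [E [[oU AE oE] Ux]]] := orthonormal_frame_ex x tt.
have oEx : orthonormal (fun i => E i x) by move=> i j; exact: oE.
have tE i : t (E i x) = 0 by have [_] := AE i.
exists (fun i => E i x); split=> //; first exact: (etaP hfor (t1 x) (tl x)).
by move=> s; exact: (An_compE hfor (t1 x) (tl x)).
Qed.

Lemma hT_Phi_eta x (v : tangent x) : hT (Phi T v) (eta x) = t v.
Proof.
have [[tl ts] t1] := tt; have [E [oE tE ne _]] := null_dual_eta x.
exact: (null_dual_t hfor (t1 x) (tl x) tE oE).
Qed.

Lemma An_comp_decomp x (s : bun T x) :
  s = hT s (eta x) *: xi x + Phi T (An_comp t s) + hT s (xi x) *: eta x.
Proof.
have [E [oE tE ne Es]] := null_dual_eta x; rewrite [LHS](null_dual_expand hfor s oE ne).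
congr (_ + _ + _); rewrite Es Phi_sum; apply: eq_bigr => i _; by rewrite PhiZ.
Qed.

Lemma hT_An_comp x (s : bun T x) (v : tangent x) : t v = 0 ->
  hT s (Phi T v) = hN (An_comp t s) v.
Proof.
move=> tv; rewrite {1}(An_comp_decomp s) !(bformDl (hTb x)) !(bformZl (hTb x)).
by rewrite hT_xi_Phi// (hT_sym (eta x)) hT_Phi_eta tv hT_Phi// !mulr0 addr0 add0r.
Qed.

Lemma An_comp_linear x a (s u : bun T x) :
  An_comp t (a *: s + u) = a *: An_comp t s + An_comp t u.
Proof.
have [E [oE tE ne Es]] := null_dual_eta x; rewrite !Es scaler_sumr -big_split.
by apply: eq_bigr => i _ /=; rewrite (bformDl (hTb x)) (bformZl (hTb x)) scalerDl scalerA.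
Qed.

Lemma D_An_linear x a (v w : tangent x) : D (a *: v + w) = a *: D v + D w.
Proof.
by rewrite /D_An -An_comp_linear -covZl -?covDl//; exact: eta_smooth.
Qed.

Lemma D_An_sum x (I : Type) (r : seq I) (c : I -> R) (v : I -> tangent x) :
  D (\sum_(i <- r) c i *: v i) = \sum_(i <- r) c i *: D (v i).
Proof.
elim: r => [|i r IH]; last by rewrite !big_cons D_An_linear IH.
have := D_An_linear (-1) (0 : tangent x) 0.
by rewrite !big_nil scaler0 addr0 scaleN1r addNr.
Qed.

Lemma nabla_An_smooth A X : smooth_field A -> smooth_field X ->
  smooth_field (fun y => nabla_An T t (A y) X).
Proof.
move=> sA sX; apply: An_comp_smooth => //; apply: cov_smooth => //; exact: smooth_PhiS.
Qed.

(** Differentiate h(Phi X, xi) = 0; the derivative of [xi] along [v] is [Phi T v] by definition. *)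
Lemma hT_cov_xi x (v : tangent x) X : smooth_field X ->
  hT (cov nab v (PhiS T X)) (xi x) = - hN (X x) v.
Proof.
move=> sX; have := nab_metric v (smooth_PhiS (T := T) sX) sxi.
rewrite (_ : (fun y => _) = fun=> 0); last by apply/funext => y; rewrite hT_Phi_xi.
rewrite tangent_cst => /eqP; rewrite eq_sym addr_eq0 => /eqP->.
by rewrite -(hT_Phi hfor).
Qed.

(** Differentiate h(Phi X, eta) = t(X) = 0; against [Phi X] only the component [D v] of the
    derivative of [eta] counts. *)
Lemma hT_cov_eta x (v : tangent x) X : An_section t X ->
  hT (cov nab v (PhiS T X)) (eta x) = - hN (X x) (D v).
Proof.
move=> [sX tX]; have := nab_metric v (smooth_PhiS (T := T) sX) (eta_smooth hfor tt).
rewrite (_ : (fun y => _) = fun=> 0); last by apply/funext => y; rewrite hT_Phi_eta.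
rewrite tangent_cst => /eqP; rewrite eq_sym addr_eq0 => /eqP->.
by rewrite hT_sym hT_An_comp// hN_sym.
Qed.

(** The inner derivative is split as a xi + Phi X' + b eta. Derivatives of [a] and [b] multiply [xi]
    and [eta], orthogonal to [Phi C]; what remains is a Phi(A), b times the derivative of [eta], and
    the derivative of [Phi X']. *)
Lemma hT_cov_cov A B X C x : smooth_field A -> smooth_field B ->
  An_section t X -> An_section t C ->
  hT (cov nab (A x) (fun y => cov nab (B y) (PhiS T X))) (Phi T (C x)) =
  hN (nabla_An T t (A x) (fun y => nabla_An T t (B y) X)) (C x)
  - hN (X x) (D (B x)) * hN (A x) (C x) - hN (X x) (B x) * hN (D (A x)) (C x).
Proof.
move=> sA sB AX [sC tC]; have [sX tX] := AX.
have sPX := smooth_PhiS (T := T) sX; have se := eta_smooth hfor tt.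
have sBX : smooth_section (fun y => cov nab (B y) (PhiS T X)) by exact: cov_smooth.
pose a y := hT (cov nab (B y) (PhiS T X)) (eta y).
pose b y := hT (cov nab (B y) (PhiS T X)) (xi y).
have sa : smooth a by exact: (hT_smooth sBX se).
have sb : smooth b by exact: (hT_smooth sBX sxi).
pose X' : field N := fun y => nabla_An T t (B y) X.
have sX' : smooth_field X' by exact: nabla_An_smooth.
have sPX' := smooth_PhiS (T := T) sX'.
have -> : (fun y => cov nab (B y) (PhiS T X)) =
    fun y => a y *: xi y + PhiS T X' y + b y *: eta y.
  by apply/functional_extensionality_dep => y; exact: An_comp_decomp.
have sax := smooth_sectionZ sa sxi; have sbe := smooth_sectionZ sb se.
rewrite cov_add//; last exact: smooth_sectionD.
rewrite cov_add// !cov_leibniz// !(bformDl (hTb x)) !(bformZl (hTb x)).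
rewrite hT_xi_Phi// (hT_sym (eta x)) hT_Phi_eta tC !mulr0 !add0r.
rewrite -[cov nab (A x) xi]/(Phi T (A x)) hT_Phi//.
rewrite !(@hT_An_comp x (cov _ _ _))//.
by rewrite /a /b hT_cov_eta// hT_cov_xi// /nabla_An /D_An; ring.
Qed.

(** The Gauss equation of the splitting: the iterated derivatives are antisymmetrised, and the
    bracket term only completes [R_An]. *)
Lemma hT_RT_An A B X C x : smooth_field A -> smooth_field B ->
  An_section t X -> An_section t C ->
  hT (RT A B (PhiS T X) x) (Phi T (C x)) =
  hN (R_An T t A B X x) (C x)
  - hN (X x) (D (B x)) * hN (A x) (C x) + hN (X x) (D (A x)) * hN (B x) (C x)
  - hN (X x) (B x) * hN (D (A x)) (C x) + hN (X x) (A x) * hN (D (B x)) (C x).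
Proof.
move=> sA sB AX AC; have [sX _] := AX; have [_ tC] := AC.
rewrite /Defs.RT /curvature !(bformBl (hTb x)) !hT_cov_cov// hT_An_comp//.
by rewrite /R_An !(bformBl (hNb x)) /nabla_An; ring.
Qed.

(** * Contraction over an orthonormal frame *)

Section Trace.
Variables (U : set N) (E : 'I_m -> field N) (x : N).
Hypotheses (oE : orthonormal_frame t U E) (Ux : U x).

Let trD := \sum_i hN (D (E i x)) (E i x).

Lemma An_expand (v : tangent x) : t v = 0 -> v = \sum_i hN v (E i x) *: E i x.
Proof.
move=> tv; have [[tl ts] t1] := tt; have [_ AE oEU] := oE.
rewrite {1}(transverse_expand hfor (t1 x) (tl x) (E := fun i => E i x) _ _ v).
- by rewrite tv scale0r add0r.
- by move=> i; have [_] := AE i.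
- by move=> i j; exact: oEU.
Qed.

Lemma parseval (v w : tangent x) : t v = 0 ->
  \sum_i hN v (E i x) * hN w (E i x) = hN w v.
Proof.
move=> tv; rewrite [v in RHS]An_expand// (bform_sumr (hNb x)).
by apply: eq_bigr => i _; rewrite (bformZr (hNb x)).
Qed.

(** Of the four correction terms, one gives -m h(D V, W), two give h(D V, W) each, by linearity of
    [D] and by [parseval], and the last gives -tr(D) h(V, W). *)
Lemma trace_RT V W : An_section t V -> An_section t W ->
  \sum_i hT (RT (E i) V (PhiS T W) x) (Phi T (E i x)) =
  Ric_An T t E V W x - (m%:R - 2) * hN (D (V x)) (W x) - trD * hN (V x) (W x).
Proof.
move=> AV AW; have [_ AE oEU] := oE; have [sV tV] := AV; have [sW tW] := AW.
under eq_bigr => i _.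
  have sEi : smooth_field (E i) by have [] := AE i.
  rewrite hT_RT_An// oEU// eqxx mulr1; over.
rewrite !big_split /= !sumrN sumr_const card_ord.
rewrite (_ : \sum_i hN (W x) (D (E i x)) * hN (V x) (E i x) = hN (D (V x)) (W x)); last first.
  rewrite [in RHS](An_expand (tV x)) D_An_sum hN_sym (bform_sumr (hNb x)).
  by apply: eq_bigr => i _; rewrite (bformZr (hNb x)) mulrC.
rewrite (parseval _ (tW x)) -mulr_sumr -/trD (hN_sym (W x) (D (V x))) (hN_sym (W x) (V x)).
rewrite /Ric_An -mulr_natl; ring.
Qed.

Lemma S_An_trD : (forall V W, An_section t V -> An_section t W ->
    \sum_i hT (RT (E i) V (PhiS T W) x) (Phi T (E i x)) = 0) ->
  S_An T t E x = 2 * (m%:R - 1) * trD.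
Proof.
move=> tr0; have [_ AE oEU] := oE.
have Ric i : Ric_An T t E (E i) (E i) x = (m%:R - 2) * hN (D (E i x)) (E i x) + trD.
  have := trace_RT (AE i) (AE i); rewrite tr0// oEU// eqxx mulr1 => /eqP.
  by rewrite eq_sym -addrA -opprD subr_eq0 => /eqP.
rewrite /S_An (eq_bigr _ (fun i _ => Ric i)) big_split /= -mulr_sumr -/trD.
by rewrite sumr_const card_ord -mulr_natl; ring.
Qed.

Lemma trace_RT_eq0 V W : (3 <= m)%N -> An_section t V -> An_section t W ->
  (forall X Y, An_section t X -> An_section t Y ->
     hN (D (X x)) (Y x) = (m%:R - 2)^-1 *
      (Ric_An T t E X Y x - S_An T t E x / (2 * (m%:R - 1)) * hN (X x) (Y x))) ->
  \sum_i hT (RT (E i) V (PhiS T W) x) (Phi T (E i x)) = 0.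
Proof.
move=> m3 AV AW schouten; have [_ AE oEU] := oE.
have m2 : (m%:R - 2 : R) != 0 by rewrite subr_eq0 eqr_nat gtn_eqF.
have m1 : (m%:R - 1 : R) != 0 by rewrite subr_eq0 (eqr_nat R m 1) gtn_eqF// ltnW.
(* Summing the Schouten formula over the frame gives (m - 2) tr(D) = S - m S / (2 (m - 1)), and the
   right-hand side is (m - 2) S / (2 (m - 1)). *)
have trDE : trD = S_An T t E x / (2 * (m%:R - 1)).
  rewrite /trD; under eq_bigr => i _ do rewrite schouten// oEU// eqxx mulr1.
  rewrite -mulr_sumr sumrB -/(S_An T t E x) sumr_const card_ord -mulr_natl.
  by field; rewrite m1 m2.
rewrite trace_RT// trDE schouten//.
by field; rewrite m1 m2.
Qed.

End Trace.

End Splitting.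

Theorem proposition7p7 (R : realType) (m : nat) (N : lightlike_manifold R m)
    (T : lightlike_extension N) (hfor : extension_for T) (hm : (3 <= m)%N)
    (hxi : forall V W : field N, smooth_field V -> smooth_field W ->
       collinear_xi (RT (T := T) V W (xi T)))
    (hZ : forall V W : field N, smooth_field V -> smooth_field W ->
       collinear_xi (RT (T := T) (ZN N) V (PhiS T W))) :
  (forall V W : field N, smooth_field V -> smooth_field W ->
     forall x : N,
       is_trace m (fun u : EN x => weyl T u (cls (V x)) (cls (W x))) 0)
  <->
  (forall t : forall x : N, tangent x -> R, transverse_form t ->
     forall X Y : field N, An_section t X -> An_section t Y ->
     forall (U : set N) (E : 'I_m -> field N), orthonormal_frame t U E ->
     forall x : N, U x ->
       hN (D_An T t (X x)) (Y x) =
       (m%:R - 2)^-1 *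
         (Ric_An T t E X Y x
          - S_An T t E x / (2 * (m%:R - 1)) * hN (X x) (Y x))).
Proof.
split=> [tr0 t tt X Y AX AY U E oE x Ux|schouten V W sV sW x].
  have [_ AE oEU] := oE.
  have oEx : orthonormal (fun i => E i x) by move=> i j; exact: oEU.
  have tr0' V W : An_section t V -> An_section t W ->
      \sum_i hT (RT (T := T) (E i) V (PhiS T W) x) (Phi T (E i x)) = 0.
    move=> [sV _] [sW _]; have := tr0 V W sV sW x.
    by move/(is_trace_weyl hfor hxi hZ 0 tt AE oEx sV sW).
  have m2 : (m%:R - 2 : R) != 0 by rewrite subr_eq0 eqr_nat gtn_eqF.
  have m1 : (m%:R - 1 : R) != 0 by rewrite subr_eq0 (eqr_nat R m 1) gtn_eqF// ltnW.
  have Ric := trace_RT hfor tt oE Ux AX AY; rewrite tr0'// in Ric.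
  rewrite (S_An_trD hfor tt oE Ux tr0').
  set d := \sum_i _ in Ric *; set r := Ric_An _ _ _ _ _ _ in Ric *.
  have -> : r = (m%:R - 2) * hN (D_An T t (X x)) (Y x) + d * hN (X x) (Y x).
    by apply/eqP; rewrite -subr_eq0 opprD addrA -Ric.
  by field; rewrite m1 m2.
have [t tt] := transverse_form_ex hfor; have [[tl ts] t1] := tt.
have [U [E [oE Ux]]] := orthonormal_frame_ex x tt; have [_ AE oEU] := oE.
have oEx : orthonormal (fun i => E i x) by move=> i j; exact: oEU.
(* Only classes modulo the radical matter for the trace, so each field may be projected to An(t)
   along [ZN], where the Schouten formula is available. *)
have proj (X : field N) : smooth_field X ->
    exists2 X' : field N, An_section t X' & cls (X x) = cls (X' x).
  move=> sX; exists (fun y => X y - t y (X y) *: ZN N y).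
    split; first by apply: smooth_fieldB => //; apply: smooth_fieldZ; [exact: ts|exact: ZN_smooth].
    by move=> y; rewrite (covectorD (tl y)) -scaleN1r !(covectorZ (tl y)) t1 mulr1 mulN1r subrr.
  by apply/cls_eqP; exists (t x (X x)); rewrite opprB addrC subrK.
have [V' AV ->] := proj V sV; have [W' AW ->] := proj W sW.
apply/(is_trace_weyl hfor hxi hZ 0 tt AE oEx AV.1 AW.1).
apply: (trace_RT_eq0 hfor tt oE Ux hm AV AW) => X Y AX AY.
exact: (schouten t tt X Y AX AY U E oE x Ux).
Qed.
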